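(* Let $p\ge 5$ be a prime and $n\ge0$. Then $$e_\omega\log_p U_n=\mathbb Z_p[\Gamma_n](\gamma_0-1-p)\,e_\omega\mathscr T_n,$$ where $\mathscr T_n=\sum_{i=0}^n p^{i-n}\zeta_{p^{i+1}}$ and $\gamma_0=\sigma_{1+p}$. Equivalently, with $\mathscr L_n=l_n\circ\log_p$, one has $e_\omega\mathscr L_n U_n=\mathbb Z_p[\Gamma_n](\gamma_0-1-p)\,e_\omega T_n$ where $T_n=\sum_{i=0}^n\zeta_{p^{i+1}}$.
   Context: Fix a primitive $p^{n+1}$-th root of unity $\zeta_{p^{n+1}}\in\overline{\mathbb{Q}}_p$ and put $\zeta_{p^{i+1}}=\zeta_{p^{n+1}}^{p^{n-i}}$. Let $K=\mathbb{Q}_p(\zeta_{p^{n+1}})$ with ring of integers $\mathcal O_n$, $U_n=1+(\zeta_{p^{n+1}}-1)\mathcal O_n$. Identify $\mathrm{Gal}(K/\mathbb{Q}_p)$ with $(\mathbb Z/p^{n+1})^\times$ via $\sigma_a(\zeta_{p^{n+1}})=\zeta_{p^{n+1}}^a$; $\Delta=\{\sigma_a:a^{p-1}\equiv1\bmod p^{n+1}\}\cong(\mathbb Z/p)^\times$, $\Gamma_n=\mathrm{Gal}(K/\mathbb{Q}_p(\zeta_p))$. $\omega:\Delta\to\mathbb Z_p^\times$ is the Teichmüller character and $e_\omega=\frac1{p-1}\sum_{\delta\in\Delta}\omega(\delta)^{-1}\delta$. $\log_p$ is the $p$-adic logarithm. For $0\le i\le n$ let $e_0=p^{-n}\sum_{\gamma\in\Gamma_n}\gamma$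 and, for $i\ge1$, $e_i=\sum_\chi e_\chi$, the sum over characters $\chi$ of $\Gamma_n$ of conductor $p^{i+1}$ (i.e. of order $p^i$), with $e_\chi=p^{-n}\sum_{\gamma\in\Gamma_n}\chi(\gamma)^{-1}\gamma$; then $l_n=\sum_{i=0}^n p^{n-i}e_i\in\mathbb Q_p[\Gamma_n]^\times$. *)

(* Defs.v *)
From HB Require Import structures.
From mathcomp Require Import all_boot all_order all_algebra all_fingroup.
From mathcomp Require Import all_solvable all_field.
From mathcomp Require Import boolp classical_sets functions cardinality fsbigop.

Set Implicit Arguments.
Unset Strict Implicit.
Unset Printing Implicit Defensive.

Import GRing.Theory.

Local Open Scope ring_scope.

(* Z_p as the inverse limit of the rings Z/p^k: an element is the compatible
   sequence of its least nonnegative residues modulo p^k.  (The condition at k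
   forces the k-th residue to be smaller than p^k.)  The proof that p is prime
   is a parameter of the type because the domain structure depends on it. *)
Record padic_int (p : nat) (p_pr : prime p) := PadicInt {
  residue : nat -> nat;
  _ : `[< forall k, residue k = (residue k.+1 %% p ^ k)%N >] }.

HB.instance Definition _ p p_pr := [isSub for @residue p p_pr].
HB.instance Definition _ p p_pr := [Choice of @padic_int p p_pr by <:].

Section PadicInt.
Context (p : nat) (p_pr : prime p).
Local Notation Zp := (padic_int p_pr).
Implicit Types x y : Zp.
Local Open Scope nat_scope.

Lemma residueE x k : residue x k = residue x k.+1 %% p ^ k.
Proof. by case: x => f /= /asboolP. Qed.

Lemma residue_mod x k : residue x k %% p ^ k = residue x k.
Proof. by rewrite [in RHS]residueE [in LHS]residueE modn_mod. Qed.

Lemma residue_add x j k : residue x (j + k) %% p ^ k = residue x k.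
Proof.
elim: j => [|j IHj]; first exact: residue_mod.
by rewrite -IHj addSn [in RHS]residueE modn_dvdm // dvdn_exp2l // leq_addl.
Qed.

Lemma padicP x y : (forall k, residue x k = residue y k) -> x = y.
Proof. by move=> e; apply: val_inj; apply: funext. Qed.

Lemma padic_of_subproof (f : nat -> nat) :
  (forall k, f k.+1 = f k %[mod p ^ k]) ->
  `[< forall k, f k %% p ^ k = (f k.+1 %% p ^ k.+1) %% p ^ k >].
Proof.
by move=> fP; apply/asboolP => k; rewrite modn_dvdm ?fP // dvdn_exp2l.
Qed.

Definition padic_of (f : nat -> nat) (fP : forall k, f k.+1 = f k %[mod p ^ k])
  : Zp := PadicInt p_pr (padic_of_subproof fP).

Fact padic_nat_subproof (m : nat) k : m = m %[mod p ^ k].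
Proof. by []. Qed.
Definition padic_nat m := padic_of (padic_nat_subproof m).

Fact padic_add_subproof x y k :
  residue x k.+1 + residue y k.+1 = residue x k + residue y k %[mod p ^ k].
Proof. by rewrite -modnDm -!residueE. Qed.
Definition padic_add x y := padic_of (padic_add_subproof x y).

Fact padic_mul_subproof x y k :
  residue x k.+1 * residue y k.+1 = residue x k * residue y k %[mod p ^ k].
Proof. by rewrite -modnMm -!residueE. Qed.
Definition padic_mul x y := padic_of (padic_mul_subproof x y).

Fact residue_ltn x k : residue x k < p ^ k.
Proof. by rewrite residueE ltn_pmod // expn_gt0 prime_gt0. Qed.

Fact padic_opp_subproof x k :
  p ^ k.+1 - residue x k.+1 = p ^ k - residue x k %[mod p ^ k].
Proof.
have lek := ltnW (residue_ltn x k); have lek1 := ltnW (residue_ltn x k.+1).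
apply/eqP; rewrite -(eqn_modDr (residue x k)) (subnK lek) [residue x k]residueE modnDmr.
by rewrite (subnK lek1) expnS modnMl modnn.
Qed.
Definition padic_opp x := padic_of (padic_opp_subproof x).

Fact padic_addA : associative padic_add.
Proof. by move=> x y z; apply: padicP => k /=; rewrite modnDmr modnDml addnA. Qed.

Fact padic_addC : commutative padic_add.
Proof. by move=> x y; apply: padicP => k /=; rewrite addnC. Qed.

Fact padic_add0 : left_id (padic_nat 0) padic_add.
Proof. by move=> x; apply: padicP => k /=; rewrite mod0n add0n residue_mod. Qed.

Fact padic_addN : left_inverse (padic_nat 0) padic_opp padic_add.
Proof.
move=> x; apply: padicP => k /=.
by rewrite modnDml subnK ?modnn ?mod0n // ltnW // residue_ltn.
Qed.

HB.instance Definition _ :=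
  GRing.isZmodule.Build Zp padic_addA padic_addC padic_add0 padic_addN.

Fact padic_mulA : associative padic_mul.
Proof. by move=> x y z; apply: padicP => k /=; rewrite modnMmr modnMml mulnA. Qed.

Fact padic_mulC : commutative padic_mul.
Proof. by move=> x y; apply: padicP => k /=; rewrite mulnC. Qed.

Fact padic_mul1 : left_id (padic_nat 1) padic_mul.
Proof. by move=> x; apply: padicP => k /=; rewrite modnMml mul1n residue_mod. Qed.

Fact padic_mulD : left_distributive padic_mul padic_add.
Proof.
move=> x y z; apply: padicP => k /=.
by rewrite modnMml modnDml modnDmr mulnDl.
Qed.

Fact padic_1neq0 : padic_nat 1 != 0%R :> Zp.
Proof.
apply/eqP => /(congr1 (fun x => residue x 1)) /=.
by rewrite expn1 mod0n modn_small // prime_gt1.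
Qed.

HB.instance Definition _ := GRing.Zmodule_isComNzRing.Build Zp
  padic_mulA padic_mulC padic_mul1 padic_mulD padic_1neq0.

Definition padic_unit : {pred Zp} := fun x => `[< exists y : Zp, (y * x = 1)%R >].

Definition padic_inv x : Zp :=
  if pselect (exists y : Zp, (y * x = 1)%R) is left e then projT1 (cid e) else x.

Fact padic_mulVx : {in padic_unit, left_inverse 1%R padic_inv *%R}.
Proof.
move=> x /asboolP ex; rewrite /padic_inv; case: pselect => // e.
exact: projT2 (cid e).
Qed.

Fact padic_unitPl x y : (y * x = 1)%R -> padic_unit x.
Proof. by move=> e; apply/asboolP; exists y. Qed.

Fact padic_inv_out : {in [predC padic_unit], padic_inv =1 id}.
Proof.
by move=> x /asboolPn ex; rewrite /padic_inv; case: pselect => // /ex.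
Qed.

HB.instance Definition _ := GRing.ComNzRing_hasMulInverse.Build Zp
  padic_mulVx padic_unitPl padic_inv_out.

Lemma padic_neq0 x : x != 0%R -> exists k, ~~ (p ^ k %| residue x k).
Proof.
move=> x0; apply: contrapT => e; move/eqP: x0; apply; apply: padicP => k /=.
rewrite mod0n -residue_mod; apply/eqP; apply: contrapT => ndvd.
by apply: e; exists k; apply/negP.
Qed.

Fact padic_mulf_eq0 x y : (x * y = 0)%R -> (x == 0%R) || (y == 0%R).
Proof.
move=> xy0; apply: contraT; rewrite negb_or.
move=> /andP[/padic_neq0[a xa] /padic_neq0[b yb]].
pose u := residue x (a + b); pose v := residue y (a + b).
have ux : ~~ (p ^ a %| u) by rewrite /dvdn /u addnC residue_add -residue_mod.
have vy : ~~ (p ^ b %| v) by rewrite /dvdn /v residue_add -residue_mod.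
have u0 : 0 < u by case: (u) ux => //; rewrite dvdn0.
have v0 : 0 < v by case: (v) vy => //; rewrite dvdn0.
have : p ^ (a + b) %| u * v.
  move/(congr1 (fun z : Zp => residue z (a + b))): xy0 => /= /eqP.
  by rewrite mod0n.
rewrite pfactor_dvdn ?muln_gt0 ?u0 // lognM //.
rewrite !pfactor_dvdn -?ltnNge // in ux vy.
by rewrite leqNgt -addnS; rewrite (leq_trans _ (leq_add ux (ltnW vy))) // addSnnS leq_add2l.
Qed.

HB.instance Definition _ := GRing.ComUnitRing_isIntegral.Build Zp padic_mulf_eq0.

End PadicInt.

Notation padic p_pr := {fraction (padic_int p_pr)}.

Section LocalCyclotomicField.
Context (p : nat) (p_pr : prime p) (n : nat).
Context (K : splittingFieldType (padic p_pr)) (z : K).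

Local Notation gal := (gal_of {:K}).
Local Notation G := ('Gal({:K} / 1%AS))%g.
Local Notation pK := (p%:R : K).

Definition Zp_in_K (a : padic_int p_pr) : K := (tofrac a)%:A.

Definition ring_of_integers : set K := [set x | integralOver Zp_in_K x].

(* Convergence for the p-adic topology of K, in which the p^m O_K form a basis
   of neighbourhoods of 0. *)
Definition padic_cvg (s : nat -> K) (y : K) : Prop :=
  forall m : nat, exists N : nat, forall k : nat, (N <= k)%N ->
    exists2 w, ring_of_integers w & s k - y = pK ^+ m * w.

(* The sum of the Mercator series, with value 0 where it diverges; it
   converges on principal units. *)
Definition log_p (u : K) : K :=
  xget 0 [set y | padic_cvg
    (fun N => \sum_(1 <= k < N.+1) (-1) ^+ k.+1 * (u - 1) ^+ k / k%:R) y].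

Definition zeta (i : nat) : K := z ^+ (p ^ (n - i)).

Definition principal_units : set K :=
  [set 1 + (z - 1) * x | x in ring_of_integers].

Definition sigma (a : nat) : gal := odflt 1%g [pick g in G | g z == z ^+ a].

Definition Delta : {set gal} :=
  [set sigma (a : 'I_(p ^ n.+1)) |
    a : 'I_(p ^ n.+1) & (a ^ p.-1 == 1 %[mod p ^ n.+1])%N].

Definition Gamma : {set gal} := ('Gal({:K} / <<1; zeta 0>>))%g.

Definition teichmuller (d : gal) : padic_int p_pr :=
  xget 0 [set w | w ^+ p.-1 = 1 /\
    exists2 a : nat, d z = z ^+ a & exists b, w - a%:R = p%:R * b].

(* Action on K of the group ring element with coefficients c supported on the
   set of automorphisms A. *)
Definition gract (A : {set gal}) (c : gal -> K) (x : K) : K :=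
  \sum_(g in A) c g * g x.

Definition e_omega (x : K) : K :=
  (p.-1)%:R^-1 * gract Delta (fun d => (Zp_in_K (teichmuller d))^-1) x.

(* Characters of Gamma, extended by 0 to all automorphisms. Gamma has exponent
   p^n and K contains the p^n-th roots of unity, so K contains the values of
   every character with values in an algebraic closure. *)
Definition Gamma_char (chi : {ffun gal -> K}) : Prop :=
  [/\ chi 1%g = 1,
      {in Gamma &, forall g h, chi (g * h)%g = chi g * chi h}
    & forall g, g \notin Gamma -> chi g = 0].

(* For 1 <= i <= n: chi factors through Gal(Q_p(zeta_{p^(i+1)})/Q_p(zeta_p))
   but not through the Galois group one level below. The two kernels are
   described by the congruences a = 1 modulo p^(i+1) and modulo p^i. *)
Definition conductor (i : nat) (chi : {ffun gal -> K}) : Prop :=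
  (forall a : nat, a = 1 %[mod p ^ i.+1] -> chi (sigma a) = 1) /\
  (exists2 a : nat, a = 1 %[mod p ^ i] & chi (sigma a) != 1).

(* The coefficient at g of the idempotent e_i. The individual e_chi have
   coefficients in K, but their sum is invariant under Gal(K/Q_p). *)
Definition e_coef (i : nat) (g : gal) : K :=
  if i == 0%N then pK ^- n
  else \sum_(chi \in [set chi | Gamma_char chi /\ conductor i chi])
         (pK ^- n * (chi g)^-1).

Definition l_n (x : K) : K :=
  gract Gamma (fun g => \sum_(i < n.+1) pK ^+ (n - i) * e_coef i g) x.

Definition L_n (u : K) : K := l_n (log_p u).

Definition script_T : K := \sum_(i < n.+1) pK ^- (n - i) * zeta i.

Definition T_n : K := \sum_(i < n.+1) zeta i.

Definition ZpGamma_span (y : K) : set K :=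
  [set gract Gamma (fun g => Zp_in_K (a g)) y
    | a in [set: gal -> padic_int p_pr]].

Definition gamma0_sub (x : K) : K := sigma (1 + p) x - x - pK * x.

End LocalCyclotomicField.

(* Main.v *)
Require Import Defs.
From HB Require Import structures.
From mathcomp Require Import all_boot all_order all_algebra all_fingroup.
From mathcomp Require Import all_solvable all_field.
From mathcomp Require Import ring zify.
From mathcomp Require Import boolp classical_sets functions cardinality fsbigop.

(* Write z for the root of unity and let phi act on Z_p[[T]] by
   phi(T) = (1 + T)^p - 1.  For F in 1 + T Z_p[T] put h = (1 - phi/p) log F; it has
   integral coefficients and no linear term, because 1 - p^(k-1) vanishes at k = 1.
   Since phi^j(T) takes the value z^(p^j) - 1 at T = z - 1, the sum of
   p^-j h(z^(p^j) - 1) over j <= n telescopes to log F(z - 1).  Conversely every h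
   in T^2 Z_p[T] arises: one solves for F degree by degree, as 1 - p^(k-1) is a unit
   for k >= 2.  So, up to constants in Q_p, which e_omega kills, log U_n is the set
   of values of these sums at the h without linear term.

   Let tau = e_omega script_T_n and let S be the Z_p[Gamma_n]-module generated by
   (gamma0 - 1 - p) tau.  For h = (1 + T)^m, e_omega sends the sum above to m tau
   modulo S: for m prime to p this is the Galois action, for p | m it follows from
   a distribution relation, using p^(n+1) tau in S.  By linearity a general h is
   sent to h'(0) tau modulo S, which vanishes when h has no linear term; and the
   generator of S comes from h = (1 + T)^(1+p) - (1 + p)(1 + T).  The second
   equality is the image of the first under l_n, which commutes with Galois, has
   coefficients in Q_p, and maps script_T_n to T_n. *)

Set Implicit Arguments.
Unset Strict Implicit.
Unset Printing Implicit Defensive.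

Import GRing.Theory.

Local Open Scope ring_scope.

(** No power series is ever formed. The logarithm of u is taken as the limit of (u^(p^m) - 1) / p^m,
    which turns h = (1 - phi/p) log F into a congruence between the polynomials F^(p^(m+1)) and
    phi(F)^(p^m) modulo p^(m+1). A polynomial h is then only an approximation, and the comparison of
    log F(z - 1) with its sum is made modulo p O_K. The loss is harmless in both directions: p O_K
    lies in log U_n by successive approximation, and each element of p O_K is, up to a constant,
    such a sum at an h without linear term. The arithmetic of K has to be established as well, since
    O_K is given as an integral closure and the Galois group abstractly. With pi = z - 1 and e = p^n
    (p - 1), the relation p (1 + pi a) = - pi^e yields O_K = Z_p[pi] and the independence of 1, ...,
    pi^(e-1), hence the degree of K and the existence of sigma_a for every a prime to p. *)

Lemma eq_sub (V : zmodType) (a b c d : V) : a = b -> c - d = a - b -> c = d.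
Proof. by move=> -> /eqP; rewrite subrr subr_eq0 => /eqP. Qed.

Lemma expr_pred (R : comNzRingType) n (a : R) : (0 < n)%N -> a ^+ n = a ^+ n.-1 * a.
Proof. by case: n => // n _; rewrite exprSr. Qed.

Lemma expr_congrM (R : comNzRingType) j (x b c : R) :
  exists d, (b + x * c) ^+ j = b ^+ j + x * d.
Proof.
elim: j => [|j [d IH]]; first by exists 0; rewrite mulr0 addr0.
by exists (b * d + c * (b ^+ j + x * d)); rewrite !exprS IH; ring.
Qed.

Lemma expr1D_linear (R : comNzRingType) (x : R) N :
  exists y : R, (1 + x) ^+ N = 1 + N%:R * x + x ^+ 2 * y.
Proof.
elim: N => [|N [y IH]]; first by exists 0; rewrite mul0r mulr0 !addr0.
by exists (N%:R + y + x * y); rewrite exprS IH -[N.+1]add1n natrD; ring.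
Qed.

Lemma expr1D_lead (R : comNzRingType) k (h : {poly R}) N : (0 < k)%N ->
  exists h' : {poly R}, (1 + 'X^k * h) ^+ N = 1 + 'X^k * (N%:R * h + 'X * h').
Proof.
case: k => // k _; elim: N => [|N [h' IH]].
  by exists 0; rewrite mul0r mulr0 addr0 mulr0 addr0.
exists (h' + 'X^k * h * (N%:R * h + 'X * h')).
by rewrite exprS IH -[N.+1]add1n natrD exprS; ring.
Qed.

(** Serves the tail of the Mercator series, where the valuation v of an index has to be beaten by
    the index itself, which is at least 2^v. *)
Lemma exp2_linear A B : exists V, forall v : nat, (V <= v)%N -> (A * (B + v) <= 2 ^ v)%N.
Proof.
exists (A + (B + A.+1))%N; elim=> [|v IH]; first by case: A.
rewrite leq_eqVlt => /predU1P[<-|]; last first.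
  rewrite ltnS => /[dup] /IH vE Av; rewrite expnS mul2n -addnn addnS mulnS addnC.
  apply: leq_add => //; apply: leq_trans vE; rewrite -{1}[A]muln1 leq_mul2l; lia.
rewrite expnD; apply: leq_mul; first exact/ltnW/ltn_expl.
rewrite [in X in (_ <= X)%N]addnS expnS; have := ltn_expl (B + A) (isT : 1 < 2)%N; lia.
Qed.

Lemma coef1_1DX (R : comNzRingType) m : ((1 + 'X) ^+ m : {poly R})`_1 = m%:R.
Proof.
elim: m => [|m IH]; first by rewrite expr0 coef1.
have c0 : forall k, ((1 + 'X) ^+ k : {poly R})`_0 = 1.
  elim=> [|k IHk]; first by rewrite expr0 coef1.
  by rewrite exprS mulrDl mul1r coefD coefXM eqxx addr0.
by rewrite exprS mulrDl mul1r coefD coefXM /= IH c0 -natr1.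
Qed.

Lemma poly_div_X (R : comNzRingType) (f : {poly R}) : exists g, f = (f`_0)%:P + 'X * g.
Proof.
elim/poly_ind: f => [|f c _]; first by exists 0; rewrite coef0 mulr0 addr0.
by exists f; rewrite coefD coefMX coefC eqxx add0r addrC commr_polyX.
Qed.

Lemma sum_root_of_unity (F : fieldType) (x : F) N : x ^+ N = 1 ->
  \sum_(k < N) x ^+ k = if x == 1 then N%:R else 0.
Proof.
move=> xN; have [->|x1] := eqVneq x 1.
  by under eq_bigr do rewrite expr1n; rewrite sumr_const card_ord.
by apply/eqP; have /eqP := subrX1 x N; rewrite xN subrr eq_sym mulf_eq0 subr_eq0 (negPf x1).
Qed.

(** The exponents divisible by p are removed from the full sum; their terms are the powers of
    [x ^+ p]. The sum over characters of exact conductor has this shape. *)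
Lemma sum_root_of_unity_coprime (F : fieldType) (p : nat) (p_pr : prime p) (x : F) i :
  x ^+ (p ^ i.+1) = 1 ->
  \sum_(k < p ^ i.+1 | ~~ (p %| k)%N) x ^+ k =
  (if x == 1 then (p ^ i.+1)%:R else 0) - (if x ^+ p == 1 then (p ^ i)%:R else 0).
Proof.
move=> xi; rewrite -(sum_root_of_unity xi) -sum_root_of_unity; last by rewrite -exprM -expnS.
have pN : (p ^ i.+1 = p * p ^ i)%N by rewrite expnS.
have lt1 (k : 'I_(p ^ i)) : (p * k < p ^ i.+1)%N.
  by rewrite pN ltn_pmul2l // prime_gt0.
have lt2 (k : 'I_(p ^ i.+1)) : (k %/ p < p ^ i)%N.
  by rewrite ltn_divLR ?prime_gt0 // mulnC -pN.
have -> : \sum_(k < p ^ i) (x ^+ p) ^+ k = \sum_(k < p ^ i.+1 | (p %| k)%N) x ^+ k.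
  rewrite (reindex_onto (fun k => Ordinal (lt1 k)) (fun k => Ordinal (lt2 k))) /=.
    apply: eq_big => k; last by rewrite exprM.
    by rewrite dvdn_mulr //=; apply/esym/eqP/val_inj; rewrite /= mulKn // prime_gt0.
  by move=> k pk; apply: val_inj; rewrite /= mulnC divnK.
by rewrite [X in _ = X - _](bigID (fun k : 'I__ => (p %| k)%N)) /= [X in _ = X - _]addrC addrK.
Qed.

(** * Powers of exponent p^m modulo powers of p *)

Section PrimePowers.
Context (R : comNzRingType) (p : nat) (p_pr : prime p).
Implicit Types a b c x y : R.

(** The middle binomial coefficients are divisible by p. The linear term is kept apart because its
    exact coefficient matters in [expr1D_prime] and [p_pi_expe]. *)
Lemma exprD_prime2 b x : exists g,
  (b + x) ^+ p = b ^+ p + p%:R * (b ^+ p.-1 * x + x ^+ 2 * g) + x ^+ p.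
Proof.
case: p p_pr => [//|[//|q]] q_pr; rewrite exprDn big_ord_recr big_ord_recl /=.
exists (\sum_(i < q) (b ^+ (q - i) * x ^+ i) *+ ('C(q.+2, i.+2) %/ q.+2)).
rewrite subnn subn0 expr0 bin0 expr0 mul1r mulr1 binn !mulr1n; congr (_ + _ + _).
rewrite big_ord_recl /= mulrDr expr1 bin1 subn1 /= mulr_natl; congr (_ + _).
rewrite 2!mulr_sumr; apply: eq_bigr => i _; rewrite /bump /= !add1n !subSS.
have /dvdnP[k ->] : (q.+2 %| 'C(q.+2, i.+2))%N by rewrite prime_dvd_bin //= !ltnS.
by rewrite mulnK // mulr_natl mulrnA mulrnAr -addn2 exprD mulrA mulrC.
Qed.

Lemma exprD_prime b x : exists g, (b + x) ^+ p = b ^+ p + p%:R * (x * g) + x ^+ p.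
Proof.
have [g ->] := exprD_prime2 b x; exists (b ^+ p.-1 + x * g).
by congr (_ + _ * _ + _); ring.
Qed.

Lemma expr1D_prime s a : (2 < p)%N -> (0 < s)%N ->
  exists d, (1 + p%:R ^+ s * a) ^+ p = 1 + p%:R ^+ s.+1 * (a + p%:R ^+ s * d).
Proof.
move=> p3 s0; have [g ->] := exprD_prime2 1 (p%:R ^+ s * a).
(* The last term has p-exponent s p, and s p >= 3 s >= 2 s + 1 because p is odd and s > 0. *)
have [k e] : exists k, (s * p = k + (s.+1 + s))%N.
  by exists (s * p - (s.+1 + s))%N; nia.
exists (a ^+ 2 * g + p%:R ^+ k * a ^+ p).
rewrite !expr1n [X in _ + X = _]exprMn -[X in _ + X * _ = _]exprM e !exprD [p%:R ^+ _.+1]exprS.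
by move: (a ^+ p) (p%:R ^+ s) (p%:R ^+ k) => x y w; ring.
Qed.

(** Every p-th power gains one factor p in a congruence; all limits of p-power maps below converge
    for this reason. *)
Lemma expr_congr s m a b c : (0 < s)%N -> a = b + p%:R ^+ s * c ->
  exists d, a ^+ (p ^ m) = b ^+ (p ^ m) + p%:R ^+ (s + m) * d.
Proof.
move=> s0 ->; elim: m => [|m [d IH]]; first by exists c; rewrite expn0 !expr1 addn0.
rewrite expnSr !exprM IH; have [g ->] := exprD_prime (b ^+ (p ^ m)) (p%:R ^+ (s + m) * d).
have [k e] : exists k, ((s + m) * p = k + (s + m).+1)%N.
  by have p1 := prime_gt1 p_pr; exists ((s + m) * p - (s + m).+1)%N; nia.
exists (d * g + p%:R ^+ k * d ^+ p).
rewrite addnS [X in _ + X = _]exprMn -[X in _ + X * _ = _]exprM e [p%:R ^+ (k + _)]exprD.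
rewrite [p%:R ^+ _.+1]exprS.
by move: (b ^+ (p ^ m) ^+ p) (d ^+ p) (p%:R ^+ (s + m)) (p%:R ^+ k) => u x y w; ring.
Qed.

End PrimePowers.

(** The substitution phi lifts Frobenius: modulo p, both F^p and phi(F) are F evaluated at 'X^p. *)
Lemma poly_frobenius (R : comNzRingType) (p : nat) (p_pr : prime p) (F : {poly R}) :
  (forall c : R, exists d, c ^+ p = c + p%:R * d) ->
  exists G, F ^+ p = F \Po ((1 + 'X) ^+ p - 1) + p%:R * G.
Proof.
move=> fermat; elim/poly_ind: F => [|F c [G IH]].
  by exists 0; rewrite comp_poly0 expr0n gtn_eqF ?prime_gt0 // mulr0 addr0.
have [g ->] := exprD_prime p_pr (F * 'X) c%:P; rewrite exprMn IH -polyC_exp.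
have [d ->] := fermat c; have [h hE] := exprD_prime p_pr (1 : {poly R}) 'X.
have {}hE : (1 + 'X) ^+ p - 1 = 'X^p + p%:R * ('X * h) by rewrite hE expr1n; ring.
rewrite comp_polyD comp_polyM comp_polyX comp_polyC hE.
exists (G * 'X^p - (F \Po ('X^p + p%:R * ('X * h))) * ('X * h) + c%:P * g + d%:P).
rewrite polyCD polyCM !rmorph_nat; move: (F \Po _) => Fh.
by ring.
Qed.

Lemma expr1DX_prime (R : comNzRingType) (p : nat) (p_pr : prime p) m :
  exists g : {poly R}, (1 + 'X) ^+ (p ^ m) = 1 + 'X^(p ^ m) + p%:R * ('X * g).
Proof.
elim: m => [|m [g IH]]; first by exists 0; rewrite !expr1 mulr0 mulr0 addr0.
rewrite expnSr exprM IH.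
have [h ->] := exprD_prime p_pr (1 + 'X^(p ^ m)) (p%:R * ('X * g)).
have [k ->] := exprD_prime p_pr 1 ('X^(p ^ m) : {poly R}).
have m0 : (0 < p ^ m)%N by rewrite expn_gt0 prime_gt0.
rewrite expr1n -exprM !(expr_pred _ (prime_gt0 p_pr)) [in 'X^(p ^ m) * k](expr_pred _ m0).
exists ('X^((p ^ m).-1) * k + p%:R * g * h + (p%:R * ('X * g)) ^+ p.-1 * g).
ring.
Qed.

(** * p-adic integers *)

Section PadicIntegers.
Context (p : nat) (p_pr : prime p).
Local Notation Zp := (padic_int p_pr).
Local Notation p_ := (p%:R : Zp).
Implicit Types x y w v : Zp.

Lemma residue0 k : residue (0 : Zp) k = 0%N.
Proof. exact: mod0n. Qed.

Lemma residue1 k : residue (1 : Zp) k = (1 %% p ^ k)%N.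
Proof. by []. Qed.

Lemma residueD x y k : residue (x + y) k = ((residue x k + residue y k) %% p ^ k)%N.
Proof. by []. Qed.

Lemma residueM x y k : residue (x * y) k = ((residue x k * residue y k) %% p ^ k)%N.
Proof. by []. Qed.

Lemma residue_nat m k : residue (m%:R : Zp) k = (m %% p ^ k)%N.
Proof.
elim: m => [|m IH]; first by rewrite mulr0n residue0 mod0n.
by rewrite -addn1 natrD residueD IH residue1 modnDm.
Qed.

Lemma residueN0 x k : residue x k = 0%N -> exists y, x = p_ ^+ k * y.
Proof.
move=> x0.
(* The quotient by p^k is the residue sequence shifted by k and divided by p^k. *)
have fP j : ((residue x (j.+1 + k) %/ p ^ k) = (residue x (j + k) %/ p ^ k) %[mod p ^ j])%N.
  rewrite !modn_divl -expnD addSn -[residue x (j + k)](residue_mod x).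
  by rewrite -residueE !residue_mod.
exists (padic_of p_pr fP); apply: padicP => j.
rewrite residueM -natrX residue_nat modnMml /=.
rewrite modnMmr mulnC divnK.
  by rewrite addnC residue_add.
by rewrite /dvdn residue_add x0.
Qed.

Lemma residue_eqmod x y k : residue x k = residue y k -> exists d, x = y + p_ ^+ k * d.
Proof.
move=> xy; have [|d e] := @residueN0 (x - y) k; last first.
  by exists d; rewrite -e addrC subrK.
have: residue (x - y + y) k = residue y k by rewrite subrK.
rewrite residueD -[X in _ = X]residue_mod => /eqP.
rewrite -[X in _ == (X %% _)%N]add0n eqn_modDr mod0n => /eqP.
by rewrite residue_mod.
Qed.

Lemma padic_approx x k : exists m y, x = m%:R + p_ ^+ k * y.
Proof.
exists (residue x k); apply: residue_eqmod.
by rewrite residue_nat residue_mod.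
Qed.

Lemma padic_sep x : (forall k, exists y, x = p_ ^+ k * y) -> x = 0.
Proof.
move=> H; apply: padicP => k; have [y ->] := H k.
by rewrite residueM -natrX residue_nat modnn mul0n mod0n residue0.
Qed.

Lemma padic_series (a : nat -> Zp) :
  exists s, forall k, exists y, s = \sum_(i < k) p_ ^+ i * a i + p_ ^+ k * y.
Proof.
pose S k := \sum_(i < k) p_ ^+ i * a i.
have SP k : (residue (S k.+1) k.+1 = residue (S k) k %[mod p ^ k])%N.
  rewrite -residueE residue_mod /S big_ord_recr [nat_of_ord _]/= residueD residueM -natrX residue_nat.
  by rewrite modnn mul0n mod0n addn0 residue_mod.
exists (padic_of p_pr SP) => k.
by apply: residue_eqmod; rewrite [LHS]/= residue_mod.
Qed.

Lemma padic_natp_neq0 : p_ != 0.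
Proof.
apply/eqP => /(congr1 (fun x => residue x 2)).
rewrite residue_nat residue0 modn_small ?ltn_Pmulr ?prime_gt1 ?prime_gt0 //.
by move=> p0; have := prime_gt0 p_pr; rewrite p0.
Qed.

Lemma padic_pX_neq0 k : p_ ^+ k != 0.
Proof. by rewrite expf_neq0 // padic_natp_neq0. Qed.

Lemma padic_p_nunit x : p_ * x <> 1.
Proof.
move=> /(congr1 (fun x => residue x 1)).
rewrite residueM residue1 residue_nat expn1 modnn mul0n mod0n modn_small //.
exact: prime_gt1.
Qed.

Lemma padic_fermat x : exists y, x ^+ p = x + p_ * y.
Proof.
have [m [y ->]] := padic_approx x 1; rewrite expr1.
have [g ->] := exprD_prime p_pr m%:R (p_ * y).
have [k ->] : exists k : Zp, m%:R ^+ p = m%:R + p_ * k.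
  rewrite -natrX (divn_eq (m ^ p) p) natrD natrM.
  have -> : (m ^ p = m %[mod p])%N by apply: fermat_little.
  by rewrite [in m%:R](divn_eq m p) natrD natrM
    ; exists ((m ^ p %/ p)%:R - (m %/ p)%:R); ring.
exists (k - y + p_ * y * g + p_ ^+ p.-1 * y ^+ p).
by rewrite exprMn [p_ ^+ p](expr_pred _ (prime_gt0 p_pr)); ring.
Qed.

Lemma unit_1Dp x : (1 + p_ * x) \is a GRing.unit.
Proof.
(* The inverse is the geometric series in [- (p_ * x)]. *)
have [s sP] := padic_series (fun i => (- x) ^+ i).
apply/unitrPr; exists s; apply/eqP; rewrite -subr_eq0; apply/eqP; apply: padic_sep => k.
have [y ->] := sP k.
exists ((1 + p_ * x) * y - (- x) ^+ k).
have -> : \sum_(i < k) p_ ^+ i * (- x) ^+ i = \sum_(i < k) (- (p_ * x)) ^+ i.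
  by apply: eq_bigr => i _; rewrite -exprMn mulrN.
have e := subrX1 (- (p_ * x)) k.
have {}e : (1 + p_ * x) * (\sum_(i < k) (- (p_ * x)) ^+ i) = 1 - (- (p_ * x)) ^+ k.
  by apply: oppr_inj; rewrite opprB e; ring.
rewrite mulrDr e -mulrN exprMn; ring.
Qed.

Lemma padic_unitP m x : ~~ (p %| m)%N -> (m%:R + p_ * x) \is a GRing.unit.
Proof.
move=> pm; have m0 : (0 < m)%N by case: m pm => //; rewrite dvdn0.
(* A Bezout relation u m = 1 + v p makes u times the given element congruent to 1 modulo p. *)
case: (egcdnP p m0) => u v e _.
have cop : gcdn m p = 1%N by apply/eqP; rewrite -/(coprime m p) coprime_sym prime_coprime.
rewrite cop in e.
have {e} : (1 + p_ * (v%:R + u%:R * x)) = u%:R * (m%:R + p_ * x).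
  by rewrite [RHS]mulrDr -[X in _ = X + _]natrM e natrD natrM; ring.
by move=> e; have := unit_1Dp (v%:R + u%:R * x); rewrite e unitrM => /andP[].
Qed.

Lemma padic_valP x : x != 0 -> exists k u, u \is a GRing.unit /\ x = p_ ^+ k * u.
Proof.
move=> x0; pose P k := `[< exists y, x = p_ ^+ k * y >].
have exP : exists k, ~~ P k.
  apply: contrapT => H; move/eqP: x0; apply; apply: padic_sep => k.
  by apply/asboolP; apply: contrapT => Pk; apply: H; exists k; apply/negP.
case: (ex_minnP exP) => -[|k]; first by case/asboolPn; exists x; rewrite mul1r.
move=> /asboolPn nPk min; have /asboolP[y xy] : P k.
  by apply: contraT => /min; rewrite ltnn.
exists k, y; split=> //; have [m [t ymt]] := padic_approx y 1.
rewrite ymt expr1; apply: padic_unitP; apply/negP => /dvdnP[l ml].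
apply: nPk; exists (l%:R + t); rewrite xy ymt ml natrM expr1 exprSr; ring.
Qed.

(** Both roots of unity are fixed by p^k-th powers, which sharpen the congruence modulo p to one
    modulo p^(k+1). *)
Lemma teichmuller_unique w v : w ^+ p.-1 = 1 -> v ^+ p.-1 = 1 ->
  (exists b, w - v = p_ * b) -> w = v.
Proof.
have fix_p (u : Zp) : u ^+ p.-1 = 1 -> forall k, u ^+ (p ^ k) = u.
  move=> u1; elim=> [|k IH]; first by rewrite expr1.
  by rewrite expnSr exprM IH (expr_pred _ (prime_gt0 p_pr)) u1 mul1r.
move=> w1 v1 [b e]; apply/eqP; rewrite -subr_eq0; apply/eqP; apply: padic_sep => k.
have [|d] := @expr_congr _ _ p_pr 1 k w v b isT; first by rewrite expr1 -e addrC subrK.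
by rewrite !fix_p // => ->; exists (p_ * d); rewrite exprD; ring.
Qed.

(** The Teichmuller lift is the limit of m^(p^k); Euler's theorem gives both the convergence and the
    order of the limit. *)
Lemma teichmuller_exists m : ~~ (p %| m)%N ->
  exists w, w ^+ p.-1 = 1 /\ exists b, w - m%:R = p_ * b.
Proof.
move=> pm.
have step k : (m ^ (p ^ k.+1) = m ^ (p ^ k) %[mod p ^ k])%N.
  case: k => [|k]; first by rewrite expn0 !modn1.
  have := @Euler_exp_totient m (p ^ k.+1); rewrite coprimeXr; last first.
    by rewrite coprime_sym prime_coprime.
  move=> /(_ isT); rewrite totient_pfactor //= => e.
  have -> : (p ^ k.+2 = p.-1 * p ^ k * p + p ^ k.+1)%N.
    rewrite -mulnA -expnSr expnS -{1}(prednK (prime_gt0 p_pr)) mulSn addnC //.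
  by rewrite expnD expnM -modnMml -modnXm e modnXm exp1n modnMml mul1n.
have wP k : exists y, padic_of p_pr step = m%:R ^+ (p ^ k) + p_ ^+ k * y.
  by apply: residue_eqmod; rewrite [LHS]/= -natrX residue_nat.
exists (padic_of p_pr step); split; last first.
  have [y ->] := wP 1; have [d ->] := padic_fermat m%:R.
  by exists (d + y); ring.
apply/eqP; rewrite -subr_eq0; apply/eqP; apply: padic_sep => k.
have [y ->] := wP k.+1; have [d ->] := expr_congrM p.-1 (p_ ^+ k.+1) (m%:R ^+ (p ^ k.+1)) y.
have [l ->] : exists l, m%:R ^+ (p ^ k.+1) ^+ p.-1 = 1 + p_ ^+ k.+1 * l.
  have := @Euler_exp_totient m (p ^ k.+1); rewrite coprimeXr; last first.
    by rewrite coprime_sym prime_coprime.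
  move=> /(_ isT); rewrite totient_pfactor //= => e.
  set N := (m ^ (p ^ k.+1 * p.-1))%N; rewrite -exprM -!natrX -/N.
  have {}e : (N %% p ^ k.+1 = 1)%N.
    have -> : N = ((m ^ (p.-1 * p ^ k)) ^ p)%N.
      by rewrite /N -expnM; congr (m ^ _)%N; rewrite expnS; lia.
    rewrite -modnXm e modnXm exp1n modn_small //.
    by rewrite -{1}(expn0 p) ltn_exp2l // prime_gt1.
  by exists (N %/ p ^ k.+1)%:R; rewrite [in LHS](divn_eq N (p ^ k.+1)) e natrD natrM addrC mulrC.
by exists (p_ * (l + d)); rewrite exprSr; ring.
Qed.

Lemma padic_nat_cong a b k (c : Zp) :
  a%:R = b%:R + p%:R ^+ k * c -> a = b %[mod p ^ k].
Proof.
move=> /(congr1 (fun t => residue t k)).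
by rewrite residueD residueM -natrX !residue_nat modnn mul0n mod0n addn0 modn_mod.
Qed.

Lemma padic_dvdp_or_unit c : (exists b, c = p%:R * b :> Zp) \/ c \is a GRing.unit.
Proof.
have [m [b ->]] := padic_approx c 1; rewrite expr1.
have [/dvdnP[k ->]|pm] := boolP (p %| m)%N; last by right; apply: padic_unitP.
by left; exists (k%:R + b); rewrite natrM; ring.
Qed.

Lemma polyXn_div_pX N j (f g : {poly Zp}) :
  p%:R ^+ N * f = 'X^j * g -> exists h, f = 'X^j * h.
Proof.
move=> e; exists (drop_poly j f).
rewrite -[LHS](poly_take_drop j f) [X in X + _](_ : _ = 0) ?add0r 1?mulrC //.
apply/polyP => i; rewrite coef_take_poly coef0; case: ltnP => // ij.
have := congr1 (fun q : {poly Zp} => q`_i) e; rewrite coefXnM ij.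
rewrite -natrX mulr_natl coefMn -mulr_natl natrX => /eqP.
by rewrite mulf_eq0 (negPf (padic_pX_neq0 _)) => /eqP.
Qed.

End PadicIntegers.

(** * Integers and logarithms in the cyclotomic field *)

Section LocalField.
Context (p : nat) (p_pr : prime p) (p3 : (2 < p)%N) (n : nat).
Local Notation Zp := (padic_int p_pr).
Context (K : fieldType) (iota : {rmorphism Zp -> K}) (iota_inj : injective iota).
Context (z : K) (z_prim : (p ^ n.+1).-primitive_root z).
(** The form in which K = Q_p(z) is used here: up to a power of p, every element lies in Z_p[z]. No
    Galois theory enters this section. *)
Hypothesis z_gen : forall x : K, exists N (f : {poly Zp}),
  p%:R ^+ N * x = (map_poly iota f).[z].
Local Notation pK := (p%:R : K).
Local Notation pi := (z - 1).
Implicit Types (x y w : K) (f g h : {poly Zp}).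

Definition peval f x : K := (map_poly iota f).[x].

Lemma pevalD f g x : peval (f + g) x = peval f x + peval g x.
Proof. by rewrite /peval rmorphD hornerD. Qed.

Lemma pevalN f x : peval (- f) x = - peval f x.
Proof. by rewrite /peval rmorphN hornerN. Qed.

Lemma pevalB f g x : peval (f - g) x = peval f x - peval g x.
Proof. by rewrite pevalD pevalN. Qed.

Lemma pevalM f g x : peval (f * g) x = peval f x * peval g x.
Proof. by rewrite /peval rmorphM hornerM. Qed.

Lemma peval_nat k x : peval k%:R x = k%:R.
Proof. by rewrite /peval rmorph_nat -polyC_natr hornerC. Qed.

Lemma peval0 x : peval 0 x = 0.
Proof. exact: (peval_nat 0). Qed.

Lemma peval1 x : peval 1 x = 1.
Proof. exact: (peval_nat 1). Qed.

Lemma pevalX x : peval 'X x = x.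
Proof. by rewrite /peval map_polyX hornerX. Qed.

Lemma pevalC c x : peval c%:P x = iota c.
Proof. by rewrite /peval map_polyC hornerC. Qed.

Lemma pevalXn f k x : peval (f ^+ k) x = peval f x ^+ k.
Proof. by rewrite /peval rmorphXn horner_exp. Qed.

Lemma peval_comp f g x : peval (f \Po g) x = peval f (peval g x).
Proof. by rewrite /peval map_comp_poly horner_comp. Qed.

Definition pevalE := (pevalB, pevalD, pevalN, pevalM, peval_nat, peval0, peval1,
  pevalX, pevalC, pevalXn, peval_comp).

Lemma pK_neq0 : pK != 0.
Proof.
by rewrite -(rmorph_nat iota) -(rmorph0 iota) (inj_eq iota_inj) padic_natp_neq0.
Qed.

Lemma pKX_neq0 k : pK ^+ k != 0.
Proof. by rewrite expf_neq0 // pK_neq0. Qed.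

Definition integral x := integralOver iota x.

Lemma integralD x y : integral x -> integral y -> integral (x + y).
Proof. exact: integral_add. Qed.

Lemma integralN x : integral x -> integral (- x).
Proof. exact: integral_opp. Qed.

Lemma integralB x y : integral x -> integral y -> integral (x - y).
Proof. exact: integral_sub. Qed.

Lemma integralM x y : integral x -> integral y -> integral (x * y).
Proof. exact: integral_mul. Qed.

Lemma integral_iota c : integral (iota c). Proof. exact: integral_id. Qed.

Lemma integralX x k : integral x -> integral (x ^+ k).
Proof.
move=> xO; elim: k => [|k IH]; first exact: integral1.
by rewrite exprS; apply: integralM.
Qed.

Lemma integral_sum (I : Type) (r : seq I) (P : pred I) (F : I -> K) :
  (forall i, P i -> integral (F i)) -> integral (\sum_(i <- r | P i) F i).
Proof.
move=> FO; elim/big_ind: _ => //; first exact: integral0.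
by move=> x y; apply: integralD.
Qed.

Lemma integral_z : integral z.
Proof.
exists ('X^(p ^ n.+1) - 1); first by rewrite monicXnsubC // expn_gt0 prime_gt0.
by rewrite rootE -/(peval _ _) !pevalE (prim_expr_order z_prim) subrr.
Qed.

Lemma integral_pi : integral pi.
Proof. by apply: integralB; [exact: integral_z | exact: integral1]. Qed.

Lemma integral_peval f x : integral x -> integral (peval f x).
Proof.
move=> xO; rewrite /peval horner_coef; apply: integral_sum => i _.
by rewrite coef_map; apply: integralM; [apply: integral_iota | apply: integralX].
Qed.

(** If p x = 1, multiplying a monic equation of degree d for x by p^d leaves 1 from the leading term
    and multiples of p elsewhere, so p would be a unit of Z_p. *)
Lemma pinv_not_integral x : integral x -> pK * x <> 1.
Proof.
move=> [f fmon]; rewrite rootE => /eqP f0 px1.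
have lc : iota (lead_coef f) = 1 by rewrite (monicP fmon); apply: rmorph1.
have := congr1 (fun t => pK ^+ (size f).-1 * t) f0; rewrite mulr0 horner_coef.
rewrite size_map_poly_id0; last first.
  by rewrite lc oner_eq0.
rewrite (polySpred (monic_neq0 fmon)) big_ord_recr /=.
rewrite [(map_poly iota f)`_(size f).-1](_ : _ = 1); last by rewrite coef_map; exact: lc.
rewrite mul1r mulrDr -exprMn px1 expr1n mulr_sumr => /eqP.
rewrite addr_eq0 => /eqP e.
apply: (@padic_p_nunit _ p_pr (- \sum_(i < (size f).-1) f`_i * p%:R ^+ ((size f).-1 - i.+1))).
apply: iota_inj; rewrite rmorphM rmorph_nat rmorphN rmorph1 rmorph_sum mulrN.
apply/eqP; rewrite eqr_oppLR -e; apply/eqP; rewrite mulr_sumr; apply: eq_bigr => i _.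
rewrite rmorphM rmorphXn rmorph_nat coef_map.
have -> : pK ^+ (size f).-1 = pK ^+ ((size f).-1 - i.+1) * (pK * pK ^+ i).
  by rewrite -exprS -exprD subnK.
transitivity (pK ^+ ((size f).-1 - i.+1) * iota f`_i * pK * (pK * x) ^+ i).
  by rewrite px1 expr1n; ring.
by rewrite exprMn; ring.
Qed.

Lemma pi_expq : exists f, pi ^+ (p ^ n.+1) = pK * peval f pi.
Proof.
have [g /(congr1 (peval^~ pi))] := @expr1DX_prime Zp p p_pr n.+1.
rewrite !pevalE addrC subrK (prim_expr_order z_prim) => e.
by exists (- ('X * g)); apply: (eq_sub (esym e)); rewrite !pevalE; ring.
Qed.

Lemma zeta0_neq1 : z ^+ (p ^ n) != 1.
Proof.
rewrite -(prim_order_dvd z_prim); apply/negP => /dvdn_leq.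
by rewrite expn_gt0 prime_gt0 // leq_exp2l ?prime_gt1 // ltnn => /(_ isT).
Qed.

(** The Eisenstein relation. With y = z^(p^n) - 1 nonzero, (1 + y)^p = 1 is divided by y; then
    y^(p-1) is compared with pi^(p^n (p-1)) modulo p pi, using y = pi^(p^n) + p pi g1. *)
Lemma p_pi_expe : exists f, pK * (1 + pi * peval f pi) = - pi ^+ (p ^ n * p.-1).
Proof.
have [g1 Y1] := @expr1DX_prime Zp p p_pr n.
have [Y YE] : exists Y : {poly Zp}, Y = 'X^(p ^ n) + p%:R * 'X * g1 by eexists.
have yE : peval Y pi = z ^+ (p ^ n) - 1.
  move/(congr1 (peval^~ pi)): Y1; rewrite !pevalE addrC subrK => ->.
  by rewrite YE !pevalE; ring.
have [g /(congr1 (peval^~ (peval Y pi)))] := exprD_prime2 p_pr (1 : {poly Zp}) 'X.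
rewrite !pevalE yE [1 + _]addrC subrK -exprM -expnSr (prim_expr_order z_prim) !expr1n mul1r.
rewrite -yE [peval Y pi ^+ p](expr_pred _ (prime_gt0 p_pr)) => e.
have {e} e : pK * (1 + peval Y pi * peval g (peval Y pi)) = - peval Y pi ^+ p.-1.
  apply: (@mulIf _ (peval Y pi)); first by rewrite yE subr_eq0 zeta0_neq1.
  by apply: (eq_sub (esym e)); ring.
have [g2 /(congr1 (peval^~ pi))] := expr_congrM p.-1 (p%:R * 'X) 'X^(p ^ n) g1.
rewrite -YE pevalXn => e2.
have [k kE] : exists k, (p ^ n)%N = k.+1.
  by exists (p ^ n).-1; rewrite prednK // expn_gt0 prime_gt0.
exists (('X^k + p%:R * g1) * (g \Po Y) + g2).
have -> : pi ^+ (p ^ n * p.-1) = peval Y pi ^+ p.-1 - pK * (pi * peval g2 pi).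
  by rewrite e2 !pevalE exprM; ring.
have yE2 : peval Y pi = pi * (pi ^+ k + pK * peval g1 pi).
  by rewrite YE !pevalE kE exprS; ring.
by apply: (eq_sub e); rewrite !pevalE yE2; ring.
Qed.

Lemma pi_not_unit w : integral w -> pi * w <> 1.
Proof.
move=> wO /(congr1 (fun t => t ^+ (p ^ n.+1))); rewrite expr1n exprMn.
have [f ->] := pi_expq; rewrite -mulrA; apply: pinv_not_integral.
apply: integralM; last exact: integralX.
exact/integral_peval/integral_pi.
Qed.

Lemma unit_not_pi_multiple c w : c \is a GRing.unit -> integral w -> iota c <> pi * w.
Proof.
move=> uc wO e; apply: (@pi_not_unit (w * iota c^-1)).
  by apply: integralM => //; apply: integral_iota.
by rewrite mulrA -e -rmorphM divrr // rmorph1.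
Qed.

Lemma p_in_pi : exists f, pK = pi * peval f pi.
Proof.
have [f e] := p_pi_expe.
have [k kE] : exists k, (p ^ n * p.-1)%N = k.+1.
  exists (p ^ n * p.-1).-1; rewrite prednK // muln_gt0 expn_gt0 prime_gt0 //=.
  by rewrite -subn1 subn_gt0 prime_gt1.
exists (- ('X^k + p%:R * f)); rewrite !pevalE; apply: (eq_sub e); rewrite kE exprS; ring.
Qed.

(** The constant term of f is pi times an integral element, so it is not a unit of Z_p. It is
    therefore divisible by p, and p is divisible by pi inside Z_p[pi]. *)
Lemma integral_pi_div f x : integral x -> pi * x = peval f pi -> exists g, x = peval g pi.
Proof.
move=> xO; have [g fE] := poly_div_X f; rewrite fE !pevalE => e.
have e1 : iota f`_0 = pi * (x - peval g pi) by rewrite mulrBr e; ring.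
have pi0 : pi != 0.
  by apply/eqP => pi0; move: zeta0_neq1; rewrite (subr0_eq pi0) expr1n eqxx.
have gO : integral (peval g pi) by apply/integral_peval/integral_pi.
have [[b fb]|uf] := padic_dvdp_or_unit f`_0; last first.
  by case: (@unit_not_pi_multiple f`_0 (x - peval g pi)) => //; apply: integralB.
have [h hE] := p_in_pi; exists (h * b%:P + g).
apply: (mulfI pi0); rewrite e fb !pevalE rmorphM rmorph_nat hE; ring.
Qed.

Lemma integral_p_div f x : integral x -> pK * x = peval f pi -> exists g, x = peval g pi.
Proof.
move=> xO e; have [h hE] := pi_expq.
have: exists g, pi ^+ (p ^ n.+1) * x = peval g pi.
  by exists (h * f); rewrite hE pevalM -e; ring.
elim: (p ^ n.+1)%N => [|k IH] [g]; first by rewrite mul1r => ->; exists g.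
rewrite exprS -mulrA => /integral_pi_div H; apply: IH; apply: H.
by apply: integralM => //; apply: integralX; apply: integral_pi.
Qed.

(** O_K = Z_p[pi]: some p^N x lies in Z_p[pi], and the factors p are removed one at a time, each as
    a power of pi. *)
Lemma integralP x : integral x -> exists f, x = peval f pi.
Proof.
have [N [f e]] := z_gen x; move=> xO.
have {}e : exists g, pK ^+ N * x = peval g pi.
  exists (f \Po (1 + 'X)); rewrite peval_comp !pevalE addrC subrK; exact: e.
elim: N e => [|N IH] [g]; first by rewrite mul1r => ->; exists g.
rewrite exprS -mulrA => /integral_p_div H; apply: IH; apply: H.
by apply: integralM => //; apply: integralX; apply: integral_nat.
Qed.

(** Only a generating family, since the powers of z below p^(n+1) are linearly dependent. The
    existence of coordinates is enough for completeness and for [pO1_Emap]. *)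
Lemma integral_basis x : integral x ->
  exists c : nat -> Zp, x = \sum_(i < p ^ n.+1) iota (c i) * z ^+ i.
Proof.
move=> /integralP[f ->].
pose m : {poly Zp} := 'X^(p ^ n.+1) - 1; pose g := f \Po ('X - 1).
have mmon : m \is monic by rewrite /m -polyC1 monicXnsubC // expn_gt0 prime_gt0.
exists (fun i => (Pdiv.CommonRing.rmodp g m)`_i).
have -> : peval f pi = peval (Pdiv.CommonRing.rmodp g m) z.
  have -> : peval f pi = peval g z by rewrite /g !pevalE.
  have m0 : peval m z = 0 by rewrite !pevalE (prim_expr_order z_prim) subrr.
  by rewrite {1}(Pdiv.RingMonic.rdivp_eq mmon g) pevalD pevalM m0 mulr0 add0r.
have sz : (size (Pdiv.CommonRing.rmodp g m) <= p ^ n.+1)%N.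
  rewrite -ltnS; have := Pdiv.CommonRing.ltn_rmodpN0 g (monic_neq0 mmon).
  by rewrite {2}/m size_XnsubC // expn_gt0 prime_gt0.
rewrite /peval (horner_coef_wide _ (leq_trans (size_poly _ _) sz)).
by apply: eq_bigr => i _; rewrite coef_map.
Qed.

(** * The p-adic topology of K *)

Definition pO k x := exists2 w, integral w & x = pK ^+ k * w.

Lemma pO_int x : pO 0 x <-> integral x.
Proof.
by split=> [[w wO ->]|xO]; [rewrite mul1r | exists x => //; rewrite mul1r].
Qed.

Lemma pOI k w : integral w -> pO k (pK ^+ k * w). Proof. by exists w. Qed.

Lemma pO0 k : pO k 0.
Proof. by exists 0; [exact: integral0 | rewrite mulr0]. Qed.

Lemma pOD k x y : pO k x -> pO k y -> pO k (x + y).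
Proof.
move=> [u uO ->] [v vO ->]; exists (u + v); first exact: integralD.
by rewrite mulrDr.
Qed.

Lemma pON k x : pO k x -> pO k (- x).
Proof. by move=> [u uO ->]; exists (- u); [exact: integralN | rewrite mulrN]. Qed.

Lemma pOB k x y : pO k x -> pO k y -> pO k (x - y).
Proof. by move=> xO yO; apply: pOD => //; apply: pON. Qed.

Lemma pOM j k x y : pO j x -> pO k y -> pO (j + k) (x * y).
Proof.
move=> [u uO ->] [v vO ->]; exists (u * v); first exact: integralM.
by rewrite exprD; ring.
Qed.

Lemma pOMl k x y : integral x -> pO k y -> pO k (x * y).
Proof. by move=> xO; apply: (@pOM 0); apply/pO_int. Qed.

Lemma pO_le j k x : (j <= k)%N -> pO k x -> pO j x.
Proof.
move=> jk [u uO ->]; exists (pK ^+ (k - j) * u).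
  by apply: integralM => //; apply: integralX; apply: integral_nat.
by rewrite mulrA -exprD subnKC.
Qed.

Lemma pO_integral k x : pO k x -> integral x.
Proof. by move/(pO_le (leq0n k))/pO_int. Qed.

Lemma pO_mulp j k x : pO k x -> pO (j + k) (pK ^+ j * x).
Proof. by apply: pOM; exists 1; [exact: integral1 | rewrite mulr1]. Qed.

Lemma pO_divp j k x : pO (j + k) (pK ^+ j * x) -> pO k x.
Proof.
by move=> [w wO]; rewrite exprD -mulrA => /(mulfI (pKX_neq0 j)) ->; exists w.
Qed.

Lemma pO_sum k (I : Type) (r : seq I) (P : pred I) (F : I -> K) :
  (forall i, P i -> pO k (F i)) -> pO k (\sum_(i <- r | P i) F i).
Proof.
move=> FO; elim/big_ind: _ => //; first exact: pO0.
by move=> x y; apply: pOD.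
Qed.

Lemma pO_dense x : exists N, integral (pK ^+ N * x).
Proof. by have [N [f e]] := z_gen x; exists N; rewrite e; apply/integral_peval/integral_z. Qed.

Lemma pO_sep x : (forall k, pO k x) -> x = 0.
Proof.
move=> xp; apply/eqP; apply: contraT => x0.
have [N NO] := pO_dense x^-1; have [w wO xw] := xp N.+1.
case: (@pinv_not_integral (pK ^+ N * x^-1 * w)); first exact: integralM.
have e := mulfV x0; rewrite {1}xw exprS in e; apply: (eq_sub e); ring.
Qed.

Lemma pO_eq x y : (forall k, pO k (x - y)) -> x = y.
Proof. by move=> /pO_sep/eqP; rewrite subr_eq0 => /eqP. Qed.

(** Completeness is inherited from Z_p: coordinates [c k i] are chosen for each difference, and the
    series of p^k [c k i] over k is summed for each i. *)
Lemma pO_complete (s : nat -> K) : (forall k, pO k (s k.+1 - s k)) ->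
  exists y, forall k, pO k (y - s k).
Proof.
move=> sP.
have /choice[c cP] k : exists c : nat -> Zp,
    s k.+1 - s k = pK ^+ k * \sum_(i < p ^ n.+1) iota (c i) * z ^+ i.
  by have [w /integral_basis[c ->] ->] := sP k; exists c.
have /choice[b bP] i := padic_series (fun k => c k i).
exists (s 0%N + \sum_(i < p ^ n.+1) iota (b i) * z ^+ i) => k.
have -> : s k = s 0%N + \sum_(i < p ^ n.+1) iota (\sum_(j < k) p%:R ^+ j * c j i) * z ^+ i.
  elim: k => [|k IH].
    by rewrite [X in _ + X]big1 ?addr0 // => i _; rewrite big_ord0 rmorph0 mul0r.
  rewrite -[LHS](subrK (s k)) cP {}IH addrC -addrA; congr (_ + _).
  rewrite mulr_sumr -big_split; apply: eq_bigr => i _ /=.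
  by rewrite big_ord_recr /= rmorphD rmorphM rmorphXn rmorph_nat; ring.
rewrite opprD addrACA subrr add0r -sumrB; apply: pO_sum => i _; rewrite -mulrBl.
have [y ->] := bP i k; rewrite -rmorphB addrC addKr rmorphM rmorphXn rmorph_nat -mulrA.
by apply: pOI; apply: integralM; [exact: integral_iota | apply/integralX/integral_z].
Qed.

(** Infinite descent: all coefficients turn out to be divisible by p, and f / p satisfies the same
    hypotheses. This will bound the degree of K from below. *)
Lemma pi_indep f : (size f <= p ^ n * p.-1)%N -> peval f pi = 0 -> f = 0.
Proof.
have e0 : (0 < p ^ n * p.-1)%N.
  by rewrite muln_gt0 expn_gt0 prime_gt0 //= -subn1 subn_gt0 prime_gt1.
have pi0 : pi != 0.
  by apply/eqP => pi0; move: zeta0_neq1; rewrite (subr0_eq pi0) expr1n eqxx.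
have div_p g : (size g <= p ^ n * p.-1)%N -> peval g pi = 0 -> exists h, g = p%:R *: h.
  move=> sg g0.
  have cP i : (i <= p ^ n * p.-1)%N -> forall j, (j < i)%N -> exists b, g`_j = p%:R * b.
    elim: i => [//|i IH] ie j; rewrite ltnS leq_eqVlt => /predU1P[->|]; last first.
      by apply: IH; apply: ltnW.
    have [//|ui] := padic_dvdp_or_unit g`_i; exfalso.
    have /choice[b bP] k : exists b, (k < i)%N -> g`_k = p%:R * b.
      case: (ltnP k i) => [ki|_]; last by exists 0.
      by have [b] := IH (ltnW ie) k ki; exists b.
    have gE : g = p%:R * (\poly_(k < i) b k) + drop_poly i g * 'X^i.
      rewrite -{1}(poly_take_drop i g); congr (_ + _); apply/polyP => k.
      rewrite mulr_natl coefMn coef_take_poly coef_poly.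
      by case: ltnP => [/bP ->|_]; rewrite ?mul0rn // mulr_natl.
    have [a aE] := p_pi_expe; have [h hE] := poly_div_X (drop_poly i g).
    (* The coefficients below i are divisible by p. The factor 1 + pi a turns this p into - pi^e
       with e > i, so after division by pi^i the unit coefficient of index i would be a multiple of
       pi. *)
    have := congr1 (fun t => (1 + pi * peval a pi) * t) g0.
    rewrite mulr0 {1}gE !pevalE; set B := peval (\poly_(k < i) b k) pi.
    have [k kE] : exists k, (p ^ n * p.-1 = i + k.+1)%N.
      by exists (p ^ n * p.-1 - i.+1)%N; rewrite addnS -addSn subnKC.
    rewrite hE !pevalE coef_drop_poly add0n => e.
    have wO : integral (pi ^+ k * B - peval a pi * (iota g`_i + pi * peval h pi) - peval h pi).
      have piO := integral_pi; have PO f1 := integral_peval f1 piO.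
      apply: integralB => //; apply: integralB.
        by apply: integralM; [apply: integralX | apply: PO].
      by apply: integralM => //; apply: integralD; [exact: integral_iota | apply: integralM].
    apply: (@unit_not_pi_multiple g`_i _ ui wO); apply: (@mulIf _ (pi ^+ i)).
      by rewrite expf_neq0.
    apply: (eq_sub e); have -> : (1 + pi * peval a pi) * (pK * B +
        (iota g`_i + pi * peval h pi) * pi ^+ i) = pK * (1 + pi * peval a pi) * B +
        (1 + pi * peval a pi) * (iota g`_i + pi * peval h pi) * pi ^+ i by ring.
    by rewrite aE kE exprD exprS; ring.
  have /choice[b bP] k : exists b, g`_k = p%:R * b.
    have [ks|] := ltnP k (size g); first by apply: (cP (size g)).
    by move=> sk; exists 0; rewrite nth_default // mulr0.
  exists (\poly_(k < size g) b k); apply/polyP => k; rewrite coefZ coef_poly.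
  by case: ltnP => [|sk]; [rewrite bP | rewrite nth_default // mulr0].
move=> sf f0.
have H k : exists g, [/\ (size g <= p ^ n * p.-1)%N, peval g pi = 0 & f = p%:R ^+ k *: g].
  elim: k => [|k [g [sg g0 fg]]]; first by exists f; rewrite scale1r.
  have [h gh] := div_p g sg g0; exists h; split.
  - by move: sg; rewrite gh size_scale // padic_natp_neq0.
  - move: g0; rewrite gh -mul_polyC pevalM pevalC rmorph_nat => /eqP.
    by rewrite mulf_eq0 (negPf pK_neq0) => /eqP.
  - by rewrite fg gh scalerA exprSr.
apply/polyP => i; rewrite coef0; apply: padic_sep => k.
by have [g [_ _ ->]] := H k; exists g`_i; rewrite coefZ.
Qed.

(** * The logarithm as a limit of p-power maps *)

Implicit Types (u v : K).

Lemma pO_expr s m x y : integral y -> (0 < s)%N -> pO s (x - y) ->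
  pO (s + m) (x ^+ (p ^ m) - y ^+ (p ^ m)).
Proof.
move=> /integralP[fy yE] s0 [w /integralP[fw wE] e].
have := @expr_congr _ _ p_pr s m (fy + p%:R ^+ s * fw) fy fw s0 erefl.
move=> [d /(congr1 (peval^~ pi))]; rewrite !pevalE -yE -wE -e addrC subrK => ->.
by rewrite addrAC subrr add0r; apply/pOI/integral_peval/integral_pi.
Qed.

Lemma expr1D_integral s x : (0 < s)%N -> integral x ->
  exists2 d, integral d & (1 + pK ^+ s * x) ^+ p = 1 + pK ^+ s.+1 * (x + pK ^+ s * d).
Proof.
move=> s0 /integralP[f ->]; have [d /(congr1 (peval^~ pi))] := expr1D_prime p_pr f p3 s0.
by rewrite !pevalE => ->; exists (peval d pi) => //; apply/integral_peval/integral_pi.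
Qed.

(* [y] is the limit of [(u ^ p^m - 1) / p^m]. *)
Definition islog u y := forall M, exists m0, forall m, (m0 <= m)%N ->
  pO (m + M) (u ^+ (p ^ m) - (1 + pK ^+ m * y)).

Definition punit u := exists2 w, integral w & u = 1 + pi * w.

Lemma islog_uniq u y y' : islog u y -> islog u y' -> y = y'.
Proof.
move=> uy uy'; apply: pO_eq => M; have [m0 P] := uy M; have [m1 Q] := uy' M.
have := pOB (Q (maxn m0 m1) (leq_maxr _ _)) (P (maxn m0 m1) (leq_maxl _ _)).
set m := maxn _ _; set t := (X in pO _ X -> _).
have -> : t = pK ^+ m * (y - y') by rewrite /t; ring.
exact: pO_divp.
Qed.

Lemma islog1 : islog 1 0.
Proof.
by move=> M; exists 0%N => m _; rewrite expr1n mulr0 addr0 subrr; apply: pO0.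
Qed.

Lemma islogM u v y y' : islog u y -> islog v y' -> islog (u * v) (y + y').
Proof.
move=> uy vy M; have [m0 P] := uy M; have [m1 Q] := vy M.
have [N NO] := pO_dense y; have [N' NO'] := pO_dense y'.
exists (m0 + m1 + N + N' + M)%N => m mm.
have {}P := P m ltac:(lia); have {}Q := Q m ltac:(lia).
rewrite exprMn; set A := u ^+ _ in P *; set B := v ^+ _ in Q *.
set a := A - _ in P; set b := B - _ in Q.
have yO k j x : integral (pK ^+ j * x) -> (j + k <= m)%N -> pO k (pK ^+ m * x).
  move=> xO jm; apply: (@pO_le _ (m - j)); first lia.
  by exists (pK ^+ j * x) => //; rewrite mulrA -exprD subnK //; lia.
have -> : A * B - (1 + pK ^+ m * (y + y')) = (pK ^+ m * y) * (pK ^+ m * y') +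
   a * (1 + pK ^+ m * y') + b * (1 + pK ^+ m * y) + a * b by rewrite /a /b; ring.
apply: pOD; first apply: pOD; first apply: pOD.
- apply: (@pO_le _ ((m - N) + (m - N'))); first lia.
  by apply: pOM; [apply: (yO _ N) | apply: (yO _ N')] => //; lia.
- rewrite mulrC; apply: pOMl => //; apply: integralD; first exact: integral1.
  by apply/pO_int/(yO _ N') => //; lia.
- rewrite mulrC; apply: pOMl => //; apply: integralD; first exact: integral1.
  by apply/pO_int/(yO _ N) => //; lia.
- by apply: pOMl => //; apply: pO_integral P.
Qed.

Lemma islog_near s u v y y' : (0 < s)%N -> integral v -> pO s (u - v) ->
  islog u y -> islog v y' -> pO s (y - y').
Proof.
move=> s0 vO uv uy vy; have [m0 P] := uy s; have [m1 Q] := vy s.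
have {}P := P (m0 + m1)%N (leq_addr _ _); have {}Q := Q (m0 + m1)%N (leq_addl _ _).
move: P Q; set m := (m0 + m1)%N => P Q; apply: (@pO_divp m).
have R := pO_expr m vO s0 uv; rewrite addnC in R; have := pOD (pOB Q P) R.
set t := (X in pO _ X -> _); suff -> : t = pK ^+ m * (y - y') by [].
by rewrite /t; ring.
Qed.

Lemma islog_exists_p s x : (0 < s)%N -> integral x ->
  exists2 y, islog (1 + pK ^+ s * x) y & pO (s + s) (y - pK ^+ s * x).
Proof.
move=> s0 xO; pose u := 1 + pK ^+ s * x.
pose a m := (u ^+ (p ^ m) - 1) / pK ^+ (m + s).
have uE m : u ^+ (p ^ m) = 1 + pK ^+ (m + s) * a m.
  by rewrite /a mulrC mulfVK ?pKX_neq0 // addrC subrK.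
have aP m : integral (a m) -> exists2 d, integral d & a m.+1 = a m + pK ^+ (m + s) * d.
  move=> aO; have [|d dO e] := @expr1D_integral (m + s) (a m) _ aO; first lia.
  exists d => //; rewrite {1}/a expnSr exprM uE e addSn.
  by rewrite [X in X / _](_ : _ = (a m + pK ^+ (m + s) * d) * pK ^+ (m + s).+1);
    [rewrite mulfK ?pKX_neq0 | ring].
have a0 : a 0%N = x by rewrite /a /u expn0 expr1 addrC addKr add0n mulrC mulKf ?pKX_neq0.
have aO m : integral (a m).
  elim: m => [|m IH]; last first.
    have [d dO ->] := aP m IH; apply: integralD => //; apply: integralM => //.
    by apply: integralX; apply: integral_nat.
  by rewrite a0.
(* Dividing by p^s before passing to the limit, and multiplying back afterwards, improves the error
   from p^k to p^(s+k). *)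
have [|y yP] := @pO_complete (fun m => a m / pK ^+ s).
  move=> m; have [d dO ->] := aP m (aO m); rewrite -mulrBl addrC addKr exprD.
  by rewrite [X in pO _ X](_ : _ = pK ^+ m * d);
   [exact: pOI | rewrite mulrAC mulfK ?pKX_neq0].
have {}yP k : pO (s + k) (pK ^+ s * y - a k).
  have := pO_mulp s (yP k); rewrite mulrBr [X in _ - X]mulrC mulfVK ?pKX_neq0 //.
exists (pK ^+ s * (pK ^+ s * y)); last first.
  by have := pO_mulp s (yP 0%N); rewrite addn0 mulrBr a0.
move=> M; exists M => m mM; rewrite -/u uE.
have := pO_mulp (m + s) (pON (yP m)); rewrite opprB => /(@pO_le (m + M)%N _) H.
rewrite [X in pO _ X](_ : _ = pK ^+ (m + s) * (a m - pK ^+ s * y)); first by apply: H; lia.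
by rewrite exprD; ring.
Qed.

Lemma punit_integral u : punit u -> integral u.
Proof.
move=> [w wO ->]; apply: integralD; first exact: integral1.
by apply: integralM => //; apply: integral_pi.
Qed.

Lemma punitM u v : punit u -> punit v -> punit (u * v).
Proof.
move=> [x xO ->] [y yO ->]; exists (x + y + pi * x * y); last by ring.
have piO := integral_pi.
by apply: integralD; [apply: integralD | apply: integralM => //; apply: integralM].
Qed.

Lemma punit_pO u : pO 1 (u - 1) -> punit u.
Proof.
move=> [w wO e]; have [f pE] := p_in_pi; exists (peval f pi * w).
  by apply: integralM => //; apply/integral_peval/integral_pi.
by apply: (eq_sub e); rewrite expr1 pE; ring.
Qed.

Lemma punit_expq u : punit u -> exists2 x, integral x & u ^+ (p ^ n.+1) = 1 + pK ^+ 1 * x.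
Proof.
move=> [w wO ->]; have [g /(congr1 (peval^~ (pi * w)))] := @expr1DX_prime Zp p p_pr n.+1.
rewrite !pevalE => ->; have [h hE] := pi_expq; have piO := integral_pi.
exists (peval h pi * w ^+ (p ^ n.+1) + pi * w * peval g (pi * w)).
  apply: integralD; apply: integralM.
  - exact: integral_peval.
  - exact: integralX.
  - exact: integralM.
  - by apply/integral_peval/integralM.
by rewrite exprMn hE expr1; ring.
Qed.

(** A p^(n+1)-th power moves u into 1 + p O_K, and log u = p^-(n+1) log(u^(p^(n+1))). *)
Lemma islog_exists u : punit u -> exists y, islog u y.
Proof.
move=> /punit_expq[x xO uE]; have [y yP _] := @islog_exists_p 1 x isT xO.
exists (y / pK ^+ n.+1) => M; have [m0 P] := yP (n.+1 + M)%N.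
exists (m0 + n.+1)%N => m mm; have {}P := P (m - n.+1)%N ltac:(lia).
rewrite -uE -exprM -expnD subnKC in P; last lia.
rewrite addnA subnK in P; last lia.
have -> : pK ^+ m * (y / pK ^+ n.+1) = pK ^+ (m - n.+1) * y.
  rewrite -{1}(@subnK n.+1 m); last lia.
  by rewrite exprD -mulrA [pK ^+ n.+1 * _]mulrC divfK ?pKX_neq0.
by [].
Qed.

(** Successive approximation: an error p^(k+1) r is corrected by the factor 1 + p^(k+1) r, whose
    logarithm differs from it by at most p^(2k+2). The products converge, and [islog_near] carries
    the logarithm to the limit. *)
Lemma islog_surj y : pO 1 y -> exists2 u, punit u & islog u y.
Proof.
move=> yO.
pose good k u := [/\ punit u & exists2 y', islog u y' & pO k.+1 (y - y')].
have step k u : good k u -> exists u', good k.+1 u' /\ pO k.+1 (u' - u).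
  move=> [uU [y' uy' [r rO yr]]].
  have [t tP tr] := @islog_exists_p k.+1 r isT rO.
  have uO := punit_integral uU.
  exists (u * (1 + pK ^+ k.+1 * r)); split; last first.
    by rewrite mulrDr mulr1 addrAC subrr add0r mulrCA; apply: pOI; apply: integralM.
  split.
    apply: punitM => //; apply: punit_pO; rewrite addrAC subrr add0r.
    by apply: (@pO_le _ k.+1) => //; apply: pOI.
  exists (y' + t); first exact: islogM.
  rewrite opprD addrA yr -opprB; apply: pON; apply: pO_le tr; lia.
have [us us0 usS] : exists2 us : nat -> K, good 0%N (us 0%N) &
    forall k, good k (us k) -> good k.+1 (us k.+1) /\ pO k.+1 (us k.+1 - us k).
  have /choice[f fP] (ku : nat * K) : exists u', good ku.1 ku.2 ->
      good ku.1.+1 u' /\ pO ku.1.+1 (u' - ku.2).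
    have [g|ng] := pselect (good ku.1 ku.2); last by exists 0 => /ng.
    by have [u' ?] := step _ _ g; exists u'.
  exists (fix us k := if k is k'.+1 then f (k', us k') else 1) => //=.
    split; first by exists 0; [exact: integral0 | rewrite mulr0 addr0].
    by exists 0; [exact: islog1 | rewrite subr0].
  by move=> k gk; exact: (fP (k, _) gk).
have usG k : good k (us k) by elim: k => // k /usS[].
have usD k : pO k.+1 (us k.+1 - us k) by have [] := usS k (usG k).
have [|u' uP] := @pO_complete (fun k => us k / pK).
  by move=> k; rewrite -mulrBl; apply: (@pO_divp 1); rewrite expr1 mulrC divfK ?pK_neq0.
have {uP} uP k : pO k.+1 (pK * u' - us k).
  have := pO_mulp 1 (uP k); rewrite add1n expr1 mulrBr [pK * (_ / _)]mulrC divfK ?pK_neq0 //.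
set u := pK * u' in uP; have uU : punit u.
  have [[w wO us1] _] := usG 0%N; have [x xO e] := uP 0%N; have [f pE] := p_in_pi.
  exists (w + peval f pi * x).
    by apply: integralD => //; apply: integralM => //; apply/integral_peval/integral_pi.
  by apply: (eq_sub e); rewrite us1 expr1 pE; ring.
exists u => //; have [y' uy'] := islog_exists uU.
suff -> : y = y' by [].
apply: pO_eq => k; have [usU [yk uk yyk]] := usG k.
apply: (@pO_le _ k.+1) => //.
have := islog_near (ltn0Sn k) (punit_integral usU) (uP k) uy' uk.
by move=> /(pOB yyk); rewrite opprB addrA subrK.
Qed.

(** * Comparison with the Mercator series *)

Lemma natr_decomp k : (0 < k)%N -> exists2 c : Zp, c \is a GRing.unit &
  k%:R = iota c * pK ^+ logn p k.
Proof.
move=> k0; have [m pm kE] := pfactor_coprime p_pr k0.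
exists m%:R; last by rewrite {1}kE natrM natrX rmorph_nat.
by have := @padic_unitP p p_pr m 0; rewrite mulr0 addr0; apply; rewrite -prime_coprime.
Qed.

Lemma natr_neq0 k : (0 < k)%N -> k%:R != 0 :> K.
Proof.
move=> /natr_decomp[c uc ->]; rewrite mulf_neq0 ?pKX_neq0 //.
by rewrite -(rmorph0 iota) (inj_eq iota_inj); apply: contraTneq uc => ->; rewrite unitr0.
Qed.

Lemma integral_pfactor_div k : (0 < k)%N -> integral (pK ^+ logn p k / k%:R).
Proof.
move=> /natr_decomp[c uc ->]; rewrite invfM mulrCA mulfV ?pKX_neq0 // mulr1.
by rewrite -rmorphV //; apply: integral_iota.
Qed.

Lemma mercator_tail u M : punit u ->
  exists K0, forall k, (K0 <= k)%N -> (0 < k)%N -> pO M ((u - 1) ^+ k / k%:R).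
Proof.
move=> [w wO ->]; rewrite addrC addKr.
pose q := (p ^ n.+1)%N; have q0 : (0 < q)%N by rewrite expn_gt0 prime_gt0.
have [V VP] := exp2_linear q M.
exists (q * (M + V))%N => k kK k0; set v := logn p k.
(* For v <= V the lower bound on k suffices; for larger v, k is at least p^v, which exceeds q (M +
   v). *)
have qk : (M + v <= k %/ q)%N.
  rewrite leq_divRL // mulnC; have [vV|Vv] := leqP v V.
    by apply: leq_trans kK; rewrite leq_mul2l leq_add2l vV orbT.
  apply: leq_trans (VP v (ltnW Vv)) _; apply: (@leq_trans (p ^ v)).
    by rewrite leq_exp2r ?prime_gt1 //; lia.
  by apply: dvdn_leq => //; apply: pfactor_dvdnn.
have xk : pO (M + v) ((pi * w) ^+ k).
  apply: pO_le qk _; rewrite {2}(divn_eq k q) exprD mulnC exprM exprMn.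
  have [f ->] := pi_expq; have piO := integral_pi.
  rewrite mulrC; apply: pOMl; first by apply/integralX/integralM.
  by rewrite !exprMn -mulrA; apply: pOI; apply: integralM;
    apply: integralX; [exact: integral_peval | exact: integralX].
apply: (@pO_divp v); rewrite addnC.
rewrite [X in pO _ X](_ : _ = pK ^+ v / k%:R * (pi * w) ^+ k); last by ring.
exact: pOMl (integral_pfactor_div k0) xk.
Qed.

(** As p^m - 1 tends to -1, the binomial coefficient tends to that of -1, namely (-1)^k. The factor
    p^N absorbs the denominators, uniformly in m. *)
Lemma binomial_pX k : exists N, forall m,
  pO m (pK ^+ N * ('C((p ^ m).-1, k)%:R - (-1) ^+ k)).
Proof.
elim: k => [|k [N NP]].
  by exists 0%N => m; rewrite bin0 expr0 subrr mulr0; apply: pO0.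
exists (logn p k.+1 + N)%N => m.
have pm : (0 < p ^ m)%N by rewrite expn_gt0 prime_gt0.
have e : 'C((p ^ m).-1, k.+1)%:R - (-1) ^+ k.+1 =
   pK ^+ m * ('C((p ^ m).-1, k)%:R / k.+1%:R) - ('C((p ^ m).-1, k)%:R - (-1) ^+ k).
  have k0 := natr_neq0 (ltn0Sn k).
  have b1 := congr1 (fun t => t%:R : K) (mul_bin_diag (p ^ m) k).
  have b2 := congr1 (fun t => t%:R : K) (binS (p ^ m).-1 k).
  rewrite prednK // natrD in b2; rewrite !natrM natrX in b1.
  by rewrite mulrA b1 [_ * _ / _]mulrAC mulfV // mul1r b2 exprS; ring.
rewrite e mulrBr exprD; apply: pOB; last first.
  by rewrite -mulrA; apply: pOMl (NP m); apply: integralX; apply: integral_nat.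
rewrite [X in pO m X](_ : _ = pK ^+ m * (pK ^+ N * 'C((p ^ m).-1, k)%:R *
   (pK ^+ logn p k.+1 / k.+1%:R))); last by ring.
apply: pOI; apply: integralM; last exact: integral_pfactor_div.
by apply: integralM; [apply: integralX|]; apply: integral_nat.
Qed.

(** The binomial expansion of (u^q - 1) / p^m, with q = p^m, is compared with the series term by
    term: finitely many coefficients are close by [binomial_pX], and both tails are small by
    [mercator_tail]. *)
Lemma islog_mercator u y : punit u -> islog u y ->
  forall M, exists N0, forall N, (N0 <= N)%N ->
  pO M (\sum_(1 <= k < N.+1) (-1) ^+ k.+1 * (u - 1) ^+ k / k%:R - y).
Proof.
move=> uU uy M; have [K0 KP] := mercator_tail M uU.
have xO : integral (u - 1).
  by apply: integralB; [exact: punit_integral | exact: integral1].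
have /choice[Ns NsP] k := binomial_pX k.
pose NN k := (Ns k.-1 + logn p k)%N.
(* A single m for all k < K0: the sum dominates the loss of precision at each of them. *)
have [m0 uP] := uy M; pose m := (m0 + M + \sum_(k < K0) NN k)%N.
have {}uP := uP m ltac:(rewrite /m; lia).
exists K0 => N KN; pose x := u - 1; pose q := (p ^ m)%N.
have q0 : (0 < q)%N by rewrite expn_gt0 prime_gt0.
have binE k : (0 < k)%N -> 'C(q, k)%:R / pK ^+ m = 'C(q.-1, k.-1)%:R / k%:R.
  case: k => // k _; have b1 := congr1 (fun t => t%:R : K) (mul_bin_diag q k).
  rewrite !natrM natrX in b1; apply: (mulfI (natr_neq0 (ltn0Sn k))).
  rewrite mulrA -b1 mulrAC mulfV ?pKX_neq0 // mul1r mulrCA mulfV ?natr_neq0 // mulr1.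
  by [].
pose B := (N + q).+1.
have uqE : (u ^+ q - 1) / pK ^+ m = \sum_(1 <= k < B) 'C(q.-1, k.-1)%:R / k%:R * x ^+ k.
  have -> : u ^+ q = \sum_(0 <= k < B) x ^+ k *+ 'C(q, k).
    rewrite (@big_cat_nat _ _ _ q.+1) //=; last by rewrite /B; lia.
    rewrite [X in _ + X](_ : _ = 0) ?addr0; last first.
      by rewrite big_nat big1 // => k /andP[qk _]; rewrite bin_small.
    by rewrite big_mkord -[u](subrK 1) -/x exprD1n.
  rewrite big_ltn // expr0 bin0 addrC addKr mulr_suml.
  apply: eq_big_nat => k /andP[k0 _]; rewrite -binE // -mulr_natr; ring.
have -> : \sum_(1 <= k < N.+1) (-1) ^+ k.+1 * (u - 1) ^+ k / k%:R - y =
  (\sum_(1 <= k < N.+1) (-1) ^+ k.+1 * (u - 1) ^+ k / k%:R - (u ^+ q - 1) / pK ^+ m) +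
  (u ^+ q - (1 + pK ^+ m * y)) / pK ^+ m.
  have -> : (u ^+ q - (1 + pK ^+ m * y)) / pK ^+ m = (u ^+ q - 1) / pK ^+ m - y.
    by rewrite opprD addrA mulrBl [_ * y / _]mulrAC divff ?pKX_neq0 // mul1r.
  by ring.
apply: pOD; last by apply: (@pO_divp m); rewrite mulrC divfK ?pKX_neq0.
have sgnO k : integral ((-1) ^+ k) by apply/integralX/integralN/integral1.
have -> : \sum_(1 <= k < N.+1) (-1) ^+ k.+1 * (u - 1) ^+ k / k%:R =
   \sum_(1 <= k < B) if (k < N.+1)%N then (-1) ^+ k.+1 * x ^+ k / k%:R else 0.
  rewrite [RHS](@big_cat_nat _ _ _ N.+1) //=; last by rewrite /B; lia.
  rewrite [X in _ = _ + X](_ : _ = 0) ?addr0; last first.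
    by rewrite big_nat big1 // => k /andP[Nk _]; rewrite ltnNge Nk.
  by rewrite big_nat [RHS]big_nat; apply: eq_bigr => k /andP[_ ->].
rewrite uqE -sumrB big_nat; apply: pO_sum => k /andP[k0 _].
have [kK|Kk] := ltnP k K0; last first.
  apply: pOB; last first.
    by rewrite -mulrA [_^-1 * _]mulrC; apply: pOMl; [apply: integral_nat | apply: KP].
  by case: ifP => _; [rewrite -mulrA; apply: pOMl; [|apply: KP] | apply: pO0].
rewrite ifT; last by lia.
have NNm : (logn p k + Ns k.-1 + M <= m)%N.
  rewrite /m (bigD1 (Ordinal kK)) //= /NN; lia.
apply: (@pO_divp (logn p k + Ns k.-1)); apply: pO_le NNm _.
rewrite [X in pO m X](_ : _ = - (pK ^+ logn p k / k%:R) * x ^+ k *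
   (pK ^+ Ns k.-1 * ('C(q.-1, k.-1)%:R - (-1) ^+ k.-1))).
  apply: pOMl (NsP _ _); apply: integralM; last exact: integralX.
  exact/integralN/integral_pfactor_div.
case: k k0 {kK} => // k _; rewrite !exprS exprD; ring.
Qed.

(** * The image of the logarithm *)

(** The geometric series in phi/p at 'X = z - 1, cut off at j = n: from j = n + 1 on z^(p^j) = 1,
    and only multiples of the constant term would be added. *)
Definition Emap f : K := \sum_(j < n.+1) pK ^- j * peval f (z ^+ (p ^ j) - 1).

Lemma EmapD f g : Emap (f + g) = Emap f + Emap g.
Proof. by rewrite -big_split; apply: eq_bigr => j _; rewrite pevalD mulrDr. Qed.

Lemma EmapN f : Emap (- f) = - Emap f.
Proof. by rewrite -sumrN; apply: eq_bigr => j _; rewrite pevalN mulrN. Qed.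

Lemma EmapB f g : Emap (f - g) = Emap f - Emap g.
Proof. by rewrite EmapD EmapN. Qed.

Lemma EmapZ c f : Emap (c%:P * f) = iota c * Emap f.
Proof. by rewrite mulr_sumr; apply: eq_bigr => j _; rewrite pevalM pevalC; ring. Qed.

Lemma Emap_sum (I : Type) (r : seq I) (F : I -> {poly Zp}) :
  Emap (\sum_(i <- r) F i) = \sum_(i <- r) Emap (F i).
Proof.
elim: r => [|i r IH]; last by rewrite !big_cons EmapD IH.
by rewrite !big_nil /Emap big1 // => j _; rewrite peval0 mulr0.
Qed.

Lemma zX_sub1 j : exists2 w, integral w & z ^+ j - 1 = pi * w.
Proof.
rewrite subrX1; exists (\sum_(i < j) z ^+ i) => //.
by apply: integral_sum => i _; apply/integralX/integral_z.
Qed.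

Lemma punit_peval h j : punit (peval (1 + 'X * h) (z ^+ j - 1)).
Proof.
have [w wO zE] := zX_sub1 j; rewrite zE; exists (w * peval h (pi * w)).
  by apply: integralM => //; apply/integral_peval/integralM => //; apply: integral_pi.
by rewrite !pevalE mulrA.
Qed.

(* As [m] grows, [g] tends to [(1 - phi/p) log f], where [phi] is substitution of
   [(1 + 'X)^p - 1] for ['X]. *)
Lemma frobenius_quotient f m : exists g,
  f ^+ (p ^ m.+1) = (f \Po ((1 + 'X) ^+ p - 1)) ^+ (p ^ m) + p%:R ^+ m.+1 * g.
Proof.
have [h e] := poly_frobenius p_pr f (@padic_fermat p p_pr).
rewrite -[p%:R]expr1 in e; have [g gE] := expr_congr p_pr m (isT : 0 < 1)%N e.
by exists g; rewrite expnS exprM gE.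
Qed.

(* The sum defining [Emap g] telescopes, its last term being [log 1 = 0]. *)
Lemma log_Emap h y : islog (peval (1 + 'X * h) pi) y -> exists m, forall g,
  (1 + 'X * h) ^+ (p ^ m.+1) =
    ((1 + 'X * h) \Po ((1 + 'X) ^+ p - 1)) ^+ (p ^ m) + p%:R ^+ m.+1 * g ->
  pO 1 (y - Emap g).
Proof.
have [F FE] : exists F, F = 1 + 'X * h by eexists.
rewrite -FE => Fy.
have /choice[ys ysP] j : exists y, islog (peval F (z ^+ (p ^ j) - 1)) y.
  by rewrite FE; apply: islog_exists; apply: punit_peval.
(* Precision n + 2: one factor p is lost between exponents p^(m+1) and p^m, up to n more in p^-j,
   and one has to remain. *)
have /choice[ms msP] j := ysP j n.+2.
pose m := (\sum_(j < n.+2) ms j)%N.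
have mP j : (j <= n.+1)%N -> (ms j <= m)%N.
  by move=> jn; rewrite /m (bigD1 (Ordinal (jn : j < n.+2)%N)) //= leq_addr.
have y0 : ys 0%N = y by apply: islog_uniq (ysP 0%N) _; rewrite expn0 expr1.
have yn : ys n.+1 = 0.
  apply: islog_uniq (ysP n.+1) _; rewrite (prim_expr_order z_prim) subrr.
  by rewrite FE !pevalE mul0r addr0; apply: islog1.
exists m => g e.
have gP j : (j <= n)%N -> pO n.+1 (peval g (z ^+ (p ^ j) - 1) - (ys j - ys j.+1 / pK)).
  move=> jn; have := congr1 (peval^~ (z ^+ (p ^ j) - 1)) e.
  rewrite pevalD pevalM !pevalXn peval_nat peval_comp pevalB pevalXn pevalD peval1 pevalX.
  rewrite [1 + _]addrC subrK -[(z ^+ _) ^+ p]exprM -expnSr => ge.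
  have P := msP j m.+1 ltac:(apply: leqW; apply: mP; lia).
  have Q := msP j.+1 m ltac:(apply: mP; lia).
  apply: (@pO_divp m.+1).
  have := pOB (pO_le _ P) Q; rewrite addSnnS => /(_ ltac:(lia)).
  rewrite -(addSnnS m n.+1).
  have tE : ys j.+1 = pK * (ys j.+1 / pK) by rewrite mulrC divfK ?pK_neq0.
  rewrite [in pK ^+ m * _]tE; move: (ys j.+1 / pK) => t.
  by congr pO; apply: (eq_sub ge); rewrite [pK ^+ m.+1]exprS; ring.
have -> : y - Emap g = - \sum_(j < n.+1) pK ^- j *
    (peval g (z ^+ (p ^ j) - 1) - (ys j - ys j.+1 / pK)).
  have -> : y = \sum_(j < n.+1) pK ^- j * (ys j - ys j.+1 / pK).
    have -> : \sum_(j < n.+1) pK ^- j * (ys j - ys j.+1 / pK) =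
       - \sum_(0 <= j < n.+1) (ys j.+1 / pK ^+ j.+1 - ys j / pK ^+ j).
      rewrite big_mkord -sumrN; apply: eq_bigr => j _.
      by rewrite exprS invfM; ring.
    by rewrite telescope_sumr // yn mul0r sub0r opprK expr0 divr1.
  by rewrite /Emap -sumrB -sumrN; apply: eq_bigr => j _; ring.
apply: pON; apply: pO_sum => j _; apply: (@pO_divp j).
rewrite mulrA mulfV ?pKX_neq0 // mul1r; have jn := ltn_ord j.
by apply: pO_le (gP j _); [rewrite addn1|].
Qed.

(** phi multiplies the lowest coefficient by p^k, so the two powers contribute p^(m+1) h0 and
    p^(m+k) h0. For k = 1 they cancel; for k >= 2 the factor is invertible. *)
Lemma frobenius_quotient_lead k h m g : (0 < k)%N ->
  (1 + 'X^k * h) ^+ (p ^ m.+1) =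
    ((1 + 'X^k * h) \Po ((1 + 'X) ^+ p - 1)) ^+ (p ^ m) + p%:R ^+ m.+1 * g ->
  exists g', g = 'X^k * ((1 - p%:R ^+ k.-1) * h`_0)%:P + 'X^(k.+1) * g'.
Proof.
move=> k0; have [a aE] := poly_div_X h.
have [b bE] : exists b : {poly Zp}, (1 + 'X) ^+ p - 1 = 'X * (p%:R + 'X * b).
  have [b' ] := @expr1D_lead Zp 1 1 p isT; rewrite !mulr1 => ->.
  by exists b'; ring.
have [c cE] : exists c, ((1 + 'X^k * h) \Po ((1 + 'X) ^+ p - 1)) =
    1 + 'X^k * (p%:R ^+ k * (h`_0)%:P + 'X * c).
  rewrite comp_polyD comp_polyM rmorph1 comp_Xn_poly bE exprMn.
  have [d ->] := expr_congrM k 'X p%:R b.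
  have [e ->] : exists e, h \Po ('X * (p%:R + 'X * b)) = (h`_0)%:P + 'X * e.
    rewrite aE comp_polyD comp_polyC comp_polyM comp_polyX -mulrA coefD coefC coefXM eqxx addr0.
    by eexists.
  exists (d * ((h`_0)%:P + 'X * e) + p%:R ^+ k * e).
  by ring.
rewrite cE.
have [u ->] := @expr1D_lead Zp k h (p ^ m.+1) k0.
have [v ->] := @expr1D_lead Zp k (p%:R ^+ k * (h`_0)%:P + 'X * c) (p ^ m) k0.
move=> e.
have [|g' gE] := @polyXn_div_pX p p_pr m.+1 k.+1 (g - 'X^k * ((1 - p%:R ^+ k.-1) * h`_0)%:P)
   (u - v + p%:R ^+ m.+1 * a - p%:R ^+ m * c); last first.
  by exists g'; rewrite -gE addrC subrK.
have cP : ((1 - p%:R ^+ k.-1) * h`_0)%:P = (1 - p%:R ^+ k.-1) * (h`_0)%:P.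
  by rewrite polyCM rmorphB rmorph1 rmorphXn rmorph_nat.
rewrite {}cP; move: (h`_0)%:P aE e => h0 ->.
case: k k0 {bE cE} => // k _; rewrite !natrX => e; apply: (eq_sub (esym e)).
rewrite [k.+1.-1]/= [p%:R ^+ m.+1]exprS [p%:R ^+ k.+1]exprS ['X^(k.+2)]exprS ['X^(k.+1)]exprS.
ring.
Qed.

(** Each z^(p^j) - 1 is a multiple of pi, and pi^(p^(n+1)) is a multiple of p; the exponent yields
    p^(n+1), of which at most p^n is spent on p^-j. *)
Lemma Emap_Xn_high s k : (p ^ n.+1 * n.+1 <= k)%N -> pO 1 (Emap ('X^k * s)).
Proof.
move=> kn; apply: pO_sum => j _; apply: (@pO_divp j).
rewrite mulrA mulfV ?pKX_neq0 // mul1r; have jn := ltn_ord j.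
apply: (@pO_le _ n.+1); first by rewrite addn1.
have [w wO zE] := zX_sub1 (p ^ j); have [f fE] := pi_expq; have piO := integral_pi.
rewrite zE pevalM pevalXn pevalX -(subnKC kn) exprD exprM exprMn fE !exprMn.
rewrite -!mulrA; apply: pOI; apply: integralM; first exact/integralX/integral_peval.
apply: integralM; first by apply/integralX/integralX.
apply: integralM; first exact: integralX.
apply: integralM; first exact: integralX.
by apply/integral_peval/integralM.
Qed.

(* Induction on [d], removing the lowest coefficient of ['X^k * s] with a factor
   [1 + c 'X^k]; this needs [1 - p^(k-1)] invertible, hence [k >= 2]. *)
Lemma Emap_log_modp d k s : (2 <= k)%N -> (p ^ n.+1 * n.+1 <= k + d)%N ->
  exists u y, [/\ punit u, islog u y & pO 1 (y - Emap ('X^k * s))].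
Proof.
elim: d k s => [|d IH] k s k2 kd.
  exists 1, 0; split; last by rewrite sub0r; apply/pON/Emap_Xn_high; rewrite -[k]addn0.
    by exists 0; [exact: integral0 | rewrite mulr0 addr0].
  exact: islog1.
have [k' kE] : exists k', k = k'.+2 by exists k.-2; lia.
have [s' sE] := poly_div_X s.
pose h0 := (1 - p%:R ^+ k.-1)^-1 * s`_0.
have uh : (1 - p%:R ^+ k.-1 : Zp) \is a GRing.unit.
  by rewrite kE /= exprS -mulrN unit_1Dp.
have kX : 'X^k * h0%:P = 'X * ('X^(k.-1) * h0%:P).
  by rewrite kE [k'.+2.-1]/= ['X^(k'.+2)]exprS mulrA.
have Fu := punit_peval ('X^(k.-1) * h0%:P) 1; rewrite -kX expr1 in Fu.
have [y Fy] := islog_exists Fu.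
have [m mP] : exists m, forall g,
  (1 + 'X^k * h0%:P) ^+ (p ^ m.+1) =
    ((1 + 'X^k * h0%:P) \Po ((1 + 'X) ^+ p - 1)) ^+ (p ^ m) + p%:R ^+ m.+1 * g ->
  pO 1 (y - Emap g) by rewrite kX in Fy *; apply: log_Emap.
have [g gE] := frobenius_quotient (1 + 'X^k * h0%:P) m.
have yg := mP g gE; have [|g' g'E] := frobenius_quotient_lead _ gE; first lia.
rewrite coefC eqxx /h0 mulVKr // in g'E.
have [||u' [y' [u'U u'y' y'E]]] := IH k.+1 (s' - g'); [lia|lia|].
exists (peval (1 + 'X^k * h0%:P) pi * u'), (y + y'); split.
- exact: punitM.
- exact: islogM.
have -> : y + y' - Emap ('X^k * s) = (y - Emap g) + (y' - Emap ('X^(k.+1) * (s' - g'))).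
  suff -> : 'X^k * s = g + 'X^(k.+1) * (s' - g') by rewrite EmapD; ring.
  by rewrite g'E {1}sE ['X^(k.+1)]exprS; ring.
exact: pOD.
Qed.

Lemma Emap_log s : exists2 u, punit u & islog u (Emap ('X^2 * s)).
Proof.
have [//||u [y [uU uy yE]]] := @Emap_log_modp (p ^ n.+1 * n.+1) 2 s; first exact: leq_addl.
have [v vU vy] := islog_surj (pON yE).
exists (u * v); first exact: punitM.
by have := islogM uy vy; rewrite opprB addrC subrK.
Qed.

Lemma Emap_X m : Emap ((1 + 'X) ^+ m) = \sum_(j < n.+1) pK ^- j * z ^+ (p ^ j * m).
Proof.
by apply: eq_bigr => j _; rewrite !pevalE [1 + _]addrC subrK exprM.
Qed.

Lemma Emap_Xp m : Emap ((1 + 'X) ^+ (p * m)) =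
  pK * (Emap ((1 + 'X) ^+ m) - z ^+ m) + pK ^- n.
Proof.
rewrite !Emap_X big_ord_recr big_ord_recl /= expn0 mul1n expr0 invr1 mul1r addrAC subrr add0r.
rewrite mulnA -expnSr exprM (prim_expr_order z_prim) expr1n mulr1; congr (_ + _).
rewrite mulr_sumr; apply: eq_bigr => j _; rewrite /bump /= add1n exprS invfM mulnA -expnSr.
by rewrite !mulrA mulfV ?pK_neq0 // mul1r.
Qed.

(** By [Emap_Xp], p z^i is the value at p (1 + 'X)^i - (1 + 'X)^(p i) plus p^-n, and the two linear
    coefficients p i cancel. *)
Lemma pO1_Emap x : pO 1 x ->
  exists f c, f`_1 = 0 /\ x = Emap f + iota c / pK ^+ n.
Proof.
move=> [w /integral_basis[c ->] ->].
exists (\sum_(i < p ^ n.+1) (c i)%:P * (p%:R * (1 + 'X) ^+ i - (1 + 'X) ^+ (p * i))).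
exists (\sum_(i < p ^ n.+1) c i); split.
  rewrite coef_sum big1 // => i _; rewrite coefCM coefB mulr_natl coefMn !coef1_1DX.
  by rewrite -mulrnA mulnC subrr mulr0.
rewrite Emap_sum rmorph_sum mulr_suml -big_split expr1 mulr_sumr; apply: eq_bigr => i _ /=.
rewrite EmapZ EmapB; have -> : p%:R = (p%:R : Zp)%:P by rewrite polyC_natr.
rewrite EmapZ rmorph_nat Emap_Xp; ring.
Qed.

Lemma log_is_Emap u y : punit u -> islog u y ->
  exists f c, f`_1 = 0 /\ y = Emap f + iota c / pK ^+ n.
Proof.
move=> [w /integralP[h ->] uE] uy.
have uF : u = peval (1 + 'X * h) pi by rewrite !pevalE.
rewrite uF in uy; have [m mP] := log_Emap uy.
have [g gE] := frobenius_quotient (1 + 'X * h) m.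
have [f [c [f1 fE]]] := pO1_Emap (mP g gE).
have [g' g'E] := @frobenius_quotient_lead 1 h m g isT gE.
exists (f + g), c; split; last by apply: (eq_sub fE); rewrite EmapD; ring.
rewrite coefD f1 g'E expr0 subrr mul0r polyC0 mulr0 !add0r.
by rewrite coefXnM.
Qed.

End LocalField.

(** * Z_p inside the extension K *)

Lemma fraction_numden (R : idomainType) (a : {fraction R}) :
  exists x y : R, y != 0 /\ a * tofrac y = tofrac x.
Proof.
elim/quotW: a => r; exists \n_r, \d_r; split; first exact: denom_ratioP.
rewrite /tofrac; unlock FracField.tofrac; rewrite -[LHS]FracField.pi_mul.
apply/eqmodP; rewrite /= FracField.equivfE /FracField.mulf.
by rewrite !numden_Ratio ?mulf_neq0 ?oner_eq0 ?denom_ratioP // !mulr1 mulrC.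
Qed.

Section Embedding.
Context (p : nat) (p_pr : prime p) (K : splittingFieldType (padic p_pr)).

Fact Zp_in_K_is_zmod : zmod_morphism (@Zp_in_K p p_pr K).
Proof. by move=> a b; rewrite /Zp_in_K rmorphB scalerBl. Qed.

Fact Zp_in_K_is_monoid : monoid_morphism (@Zp_in_K p p_pr K).
Proof.
split; first by rewrite /Zp_in_K rmorph1 scale1r.
by move=> a b; rewrite /Zp_in_K rmorphM -scalerAl mul1r scalerA.
Qed.

HB.instance Definition _ := GRing.isZmodMorphism.Build _ _ (@Zp_in_K p p_pr K) Zp_in_K_is_zmod.
HB.instance Definition _ := GRing.isMonoidMorphism.Build _ _ (@Zp_in_K p p_pr K) Zp_in_K_is_monoid.

Definition padic_embedding : {rmorphism padic_int p_pr -> K} := @Zp_in_K p p_pr K.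

Lemma padic_embedding_inj : injective padic_embedding.
Proof.
move=> a b; rewrite /padic_embedding /= /Zp_in_K => /eqP.
rewrite -subr_eq0 -scalerBl scaler_eq0 oner_eq0 orbF subr_eq0 => /eqP e.
by apply/eqP; rewrite -tofrac_eq e.
Qed.

Lemma padic_scale_int (c : padic p_pr) : exists N (a : padic_int p_pr),
  (p%:R : K) ^+ N * c%:A = padic_embedding a.
Proof.
have [a [b [b0 e]]] := fraction_numden c.
have [k [u [uu bE]]] := padic_valP b0.
exists k, (a * u^-1).
have -> : (p%:R : K) ^+ k = padic_embedding (p%:R ^+ k).
  by rewrite rmorphXn rmorph_nat.
rewrite /= /Zp_in_K -scalerAl mul1r scalerA; congr (_%:A).
rewrite tofracM -e bE tofracM -!mulrA -tofracM divrr // tofrac1 mulr1 mulrC //.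
Qed.

End Embedding.

(** * Galois action *)

Section Cyclotomic.
Context (p : nat) (p_pr : prime p) (p3 : (2 < p)%N) (n : nat).
Context (K : splittingFieldType (padic p_pr)) (z : K).
Hypothesis z_prim : (p ^ n.+1).-primitive_root z.
Hypothesis K_gen : <<1; z>>%VS = fullv.
Local Notation Zp := (padic_int p_pr).
Context (iota : {rmorphism Zp -> K}).
Hypothesis iotaE : forall a, iota a = Zp_in_K K a.
Local Notation pK := (p%:R : K).
Local Notation gal := (gal_of {:K}).
Local Notation q := (p ^ n.+1)%N.
Implicit Types (g h : gal) (x y : K).

Lemma iota_inj : injective iota.
Proof. by move=> a b; rewrite !iotaE => /(@padic_embedding_inj p p_pr K). Qed.

Lemma poly1_int (f : {poly K}) : f \is a polyOver 1%VS ->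
  exists N (g : {poly Zp}), (size g <= size f)%N /\ pK ^+ N *: f = map_poly iota g.
Proof.
move=> /polyOverP f1.
have /choice[Ns /choice[a aP]] i : exists N (a : Zp), pK ^+ N * f`_i = iota a.
  have /vlineP[c ->] := f1 i; have [N [a aE]] := padic_scale_int K c.
  by exists N, a; rewrite iotaE.
pose N := (\sum_(i < size f) Ns i)%N.
exists N, (\poly_(i < size f) (p%:R ^+ (N - Ns i) * a i)); split; first exact: size_poly.
apply/polyP => i; rewrite coefZ [RHS](coef_map iota) coef_poly -[RHS]/(iota _).
case: ltnP => [ifs|fi]; last first.
  by rewrite nth_default // mulr0; apply/esym/rmorph0.
rewrite rmorphM rmorphXn rmorph_nat -aP mulrA -exprD subnK //.
by rewrite /N (bigD1 (Ordinal ifs)) //= leq_addr.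
Qed.

Lemma K_dense x : exists N (f : {poly Zp}), pK ^+ N * x = (map_poly iota f).[z].
Proof.
have : x \in <<1; z>>%VS by rewrite K_gen memvf.
move=> /Fadjoin_polyP[f /poly1_int[N [g [_ e]]] ->].
by exists N, g; rewrite -e hornerZ.
Qed.

(** A minimal polynomial of smaller degree, cleared of denominators and shifted by 1, would
    contradict [pi_indep]. *)
Lemma adjoin_degree_z : (p ^ n * p.-1 <= adjoin_degree 1 z)%N.
Proof.
rewrite leqNgt; apply/negP => small.
have [N [g [sg e]]] := poly1_int (minPolyOver 1%AS z).
rewrite size_minPoly in sg.
have gz : peval iota g z = 0 by rewrite /peval -e hornerZ minPolyxx mulr0.
have g0 : g \Po (1 + 'X) = 0.
  apply: (pi_indep iota_inj z_prim).
    rewrite (size_comp_poly2 g) ?(leq_trans sg) //.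
    by rewrite addrC -polyC1 size_XaddC.
  by rewrite peval_comp !pevalE addrC subrK.
have {}g0 : g = 0.
  have := congr1 (fun f => f \Po ('X - 1)) g0; rewrite comp_poly0 -comp_polyA.
  by rewrite comp_polyD comp_polyX rmorph1 addrC subrK comp_polyXr.
have /eqP := e; rewrite g0 rmorph0 -mul_polyC mulf_eq0 polyC_eq0.
by rewrite (negPf (pKX_neq0 iota_inj N)) (negPf (monic_neq0 (monic_minPoly _ _))).
Qed.

Lemma iota_neq0 c : c != 0 -> iota c != 0.
Proof. by move=> c0; rewrite -(rmorph0 iota) (inj_eq iota_inj). Qed.

Lemma galois_K : galois 1 {:K}.
Proof.
apply/splitting_galoisField; exists ('X^q - 1); split.
- by rewrite rpredB ?rpredX ?polyOverX ?rpred1.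
- apply: separable_Xn_sub_1; rewrite natrX.
  exact: (pKX_neq0 iota_inj).
exists [seq z ^+ i | i <- index_iota 0 q].
  by rewrite big_map (factor_Xn_sub_1 z_prim) eqpxx.
apply/eqP; rewrite eqEsubv subvf.
suff H : (<<1; z>> <= <<1 & [seq (z ^+ i)%R | i <- index_iota 0 q]>>)%VS by rewrite K_gen in H.
rewrite -adjoin_seq1 adjoin_seqSr // => x.
rewrite inE => /eqP ->; apply/mapP; exists 1%N; last by rewrite expr1.
by rewrite mem_index_iota /= -{1}(expn0 p) ltn_exp2l // prime_gt1.
Qed.

Lemma card_gal : (p ^ n * p.-1 <= #|'Gal({:K} / 1)%g|)%N.
Proof.
rewrite -(galois_dim galois_K) -[X in (\dim X)%N]K_gen dim_Fadjoin.
by rewrite dimv1 muln1 divn1 adjoin_degree_z.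
Qed.

Lemma gal_iota g c : g (iota c) = iota c.
Proof. by rewrite iotaE /Zp_in_K linearZ /= rmorph1. Qed.

Lemma gal_ext g h : g z = h z -> g = h.
Proof.
move=> gh; apply/eqP/gal_eqP => x _.
have [N [f e]] := K_dense x.
apply: (mulfI (pKX_neq0 iota_inj N)).
have eg (k : gal) : pK ^+ N * k x = (map_poly iota f).[k z].
  have kp : k (pK ^+ N) = pK ^+ N by rewrite rmorphXn rmorph_nat.
  rewrite -[LHS]/(_ * _) -{1}kp -rmorphM e !horner_coef rmorph_sum; apply: eq_bigr => i _.
  by rewrite rmorphM rmorphXn; congr (_ * _); rewrite (coef_map iota); apply: gal_iota.
by rewrite !eg gh.
Qed.

Lemma gal_z g : {a : 'I_q | g z = z ^+ a}.
Proof.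
by apply: (prim_rootP z_prim); rewrite -rmorphXn (prim_expr_order z_prim) rmorph1.
Qed.

Lemma gal_z_coprime g a : g z = z ^+ a -> coprime p a.
Proof.
move=> ga; rewrite prime_coprime //; apply/negP => /dvdnP[b ab].
have : g (z ^+ (p ^ n)) = 1.
  by rewrite rmorphXn /= ga ab -exprM -mulnA -expnS mulnC exprM (prim_expr_order z_prim) expr1n.
move/eqP; rewrite fmorph_eq1 => /eqP e.
by have := zeta0_neq1 p_pr z_prim; rewrite e eqxx.
Qed.

Lemma in_gal g : g \in 'Gal({:K} / 1)%g.
Proof. by rewrite gal_kHom ?sub1v // k1AHom. Qed.

(** By counting: an automorphism is determined by its exponent at z, and there are at least as many
    automorphisms as exponents prime to p. *)
Lemma sigma_exists a : coprime p a -> exists g, g z = z ^+ a.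
Proof.
move=> ca; pose E g : 'I_q := sval (gal_z g).
have EP g : g z = z ^+ E g by rewrite /E; case: gal_z.
have E_inj : {in 'Gal({:K} / 1)%g &, injective E}.
  by move=> g h _ _ gh; apply: gal_ext; rewrite !EP gh.
have cardE : #|[set b : 'I_q | coprime p b]| = (p ^ n * p.-1)%N.
  rewrite mulnC -(totient_pfactor p_pr (ltn0Sn n)) totient_count_coprime.
  rewrite big_mkord -sum1dep_card big_mkcond; apply: eq_bigr => i _.
  by rewrite coprime_pexpl //; case: coprime.
have /eqP imE : E @: 'Gal({:K} / 1)%g == [set b : 'I_q | coprime p b].
  rewrite eqEcard card_in_imset // cardE card_gal andbT.
  by apply/fintype.subsetP => _ /imsetP[g _ ->]; rewrite inE; apply: gal_z_coprime (EP g).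
have q0 : (0 < q)%N by rewrite expn_gt0 prime_gt0.
have : Ordinal (ltn_pmod a q0) \in E @: 'Gal({:K} / 1)%g.
  rewrite imE inE /= -(coprime_pexpl _ _ (ltn0Sn n)) coprime_modr.
  by rewrite coprime_pexpl.
by move=> /imsetP[g _ eg]; exists g; rewrite EP -eg /= (prim_expr_mod z_prim).
Qed.

Lemma sigmaE a : coprime p a -> sigma z a z = z ^+ a.
Proof.
move=> /sigma_exists[g ga]; rewrite /sigma; case: pickP => [h /andP[_ /eqP] //|/(_ g)].
by rewrite in_gal ga eqxx.
Qed.

Lemma gal_mul g h x : (g * h)%g x = h (g x).
Proof. by rewrite galM // memvf. Qed.

Lemma galC g h : (g * h = h * g)%g.
Proof.
apply: gal_ext; rewrite !gal_mul; have [a ga] := gal_z g; have [b hb] := gal_z h.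
by rewrite ga hb !rmorphXn /= ga hb -!exprM mulnC.
Qed.

Lemma gal_comm g h x : g (h x) = h (g x).
Proof. by rewrite -!gal_mul galC. Qed.

Lemma ring_of_integersE x : ring_of_integers x <-> integral iota x.
Proof.
have e f : map_poly (@Zp_in_K p p_pr K) f = map_poly iota f.
  by apply: eq_map_poly => a; rewrite iotaE.
by split=> -[f fm fx]; exists f => //; move: fx; rewrite e.
Qed.

Lemma principal_unitsE u : principal_units z u <-> punit iota z u.
Proof.
split=> [[x /ring_of_integersE xO <-]|[x xO ->]]; first by exists x.
by exists x => //; apply/ring_of_integersE.
Qed.

(** The Mercator sums converge to y, and uniqueness of limits identifies y with the chosen value. *)
Lemma log_pE u y : punit iota z u -> islog iota u y -> log_p u = y.
Proof.
move=> uU uy; rewrite /log_p; set S := (X in xget _ X).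
have Sy : S y.
  move=> m; have [N NP] := islog_mercator p3 iota_inj z_prim uU uy m.
  by exists N => k /NP[w wO ->]; exists w => //; apply/ring_of_integersE.
have : S (xget 0 S) by apply: xgetPex; exists y.
move: (xget 0 S) => y' Sy'; apply: (pO_eq iota_inj z_prim K_dense) => M.
have [N NP] := Sy M; have [N' NP'] := Sy' M.
have [w /ring_of_integersE wO e] := NP (N + N')%N (leq_addr _ _).
have [w' /ring_of_integersE wO' e'] := NP' (N + N')%N (leq_addl _ _).
exists (w - w'); first exact: integralB.
by rewrite mulrBr -e -e'; ring.
Qed.

(** * The Teichmuller character and e_omega *)

Lemma prim_cong a b : z ^+ a = z ^+ b -> exists c : Zp, a%:R = b%:R + p%:R ^+ n.+1 * c :> Zp.
Proof.
move=> /eqP; rewrite (eq_prim_root_expr z_prim) => /eqP ab.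
by apply: residue_eqmod; rewrite !residue_nat.
Qed.

Lemma cong_prim a b (c : Zp) : a%:R = b%:R + p%:R ^+ n.+1 * c -> z ^+ a = z ^+ b.
Proof.
by move=> /padic_nat_cong ab; apply/eqP; rewrite (eq_prim_root_expr z_prim) ab.
Qed.

Lemma teichmullerP g a : g z = z ^+ a ->
  teichmuller z g ^+ p.-1 = 1 /\ exists b, teichmuller z g - a%:R = p%:R * b.
Proof.
move=> ga; rewrite /teichmuller; set S := (X in xget _ X).
have pa : ~~ (p %| a)%N by rewrite -prime_coprime // (gal_z_coprime ga).
have : S (xget 0 S).
  apply: xgetPex; have [w [w1 [b wb]]] := teichmuller_exists p_pr pa.
  by exists w; split=> //; exists a => //; exists b.
move=> [w1 [a' ga' [b' wb']]]; split=> //.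
have [|c cE] := @prim_cong a' a; first by rewrite -ga -ga'.
by exists (b' + p%:R ^+ n * c); apply: (eq_sub wb'); rewrite cE exprS; ring.
Qed.

Lemma teichmuller_eq g a w : g z = z ^+ a -> w ^+ p.-1 = 1 ->
  (exists b, w - a%:R = p%:R * b) -> teichmuller z g = w.
Proof.
move=> ga w1 [b wb]; have [t1 [b' tb']] := teichmullerP ga.
apply: (teichmuller_unique t1 w1); exists (b' - b).
by rewrite mulrBr -tb' -wb; ring.
Qed.

Lemma teichmullerM g h :
  teichmuller z (g * h)%g = teichmuller z g * teichmuller z h.
Proof.
have [a ga] := gal_z g; have [b hb] := gal_z h.
have [g1 [c gc]] := teichmullerP ga; have [h1 [d hd]] := teichmullerP hb.
apply: (@teichmuller_eq _ (b * a)).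
- by rewrite gal_mul ga rmorphXn /= hb exprM.
- by rewrite exprMn g1 h1 mulr1.
exists (c * teichmuller z h + d * a%:R).
by rewrite mulrDr !mulrA -gc -hd natrM; ring.
Qed.

Lemma teichmuller_neq0 g : iota (teichmuller z g) != 0.
Proof.
have [a ga] := gal_z g; have [g1 _] := teichmullerP ga.
apply: iota_neq0; apply: contraPneq g1 => ->; rewrite expr0n.
have : (p.-1 != 0)%N by have := prime_gt1 p_pr; case: (p) => [|[]].
by move=> /negPf -> /esym/eqP; rewrite oner_eq0.
Qed.

Lemma gal_expg g a k : g z = z ^+ a -> (g ^+ k)%g z = z ^+ (a ^ k).
Proof.
move=> ga; elim: k => [|k IH]; first by rewrite expg0 gal_id expn0 expr1.
by rewrite expgSr gal_mul IH rmorphXn /= ga -exprM expnS.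
Qed.

Lemma DeltaP g : (g \in Delta n z) = (g ^+ p.-1 == 1)%g.
Proof.
have q1 : (1 < q)%N by rewrite -{1}(expn0 p) ltn_exp2l // prime_gt1.
have key h a : h z = z ^+ a -> (h ^+ p.-1 == 1)%g = (a ^ p.-1 == 1 %[mod q])%N.
  move=> ha; rewrite -(eq_prim_root_expr z_prim) -(gal_expg _ ha) expr1.
  by apply/eqP/eqP => [->|e]; [rewrite gal_id | apply: gal_ext; rewrite gal_id].
apply/imsetP/idP => [[a]|g1].
  rewrite inE => a1 ->; rewrite (key _ a) // sigmaE //.
  rewrite prime_coprime //; apply/negP => pa.
  move: a1; rewrite (modn_small q1) => /eqP/(congr1 (modn^~ p)).
  have p1 : (0 < p.-1)%N by rewrite -subn1 subn_gt0 prime_gt1.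
  rewrite modn_dvdm ?dvdn_exp // (modn_small (prime_gt1 p_pr)).
  have : (p %| a ^ p.-1)%N by rewrite (dvdn_trans pa) // dvdn_exp.
  by rewrite /dvdn => /eqP ->.
have [a ga] := gal_z g; exists a; first by rewrite inE -(key g).
by apply: gal_ext; rewrite sigmaE // (gal_z_coprime ga).
Qed.

Lemma Delta_mulr g h : g \in Delta n z -> ((g * h)%g \in Delta n z) = (h \in Delta n z).
Proof.
rewrite !DeltaP => /eqP g1.
by rewrite expgMn ?g1 ?mul1g //; apply: galC.
Qed.

Lemma gal_inv_iota g c : g (iota c)^-1 = (iota c)^-1.
Proof. by rewrite fmorphV /= gal_iota. Qed.

Lemma gal_nat g m : g m%:R = m%:R.
Proof. exact: rmorph_nat. Qed.

Lemma e_omegaE x : e_omega n z x =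
  (p.-1)%:R^-1 * \sum_(g in Delta n z) (iota (teichmuller z g))^-1 * g x.
Proof.
by rewrite /e_omega /gract; congr (_ * _); apply: eq_bigr => g _; rewrite iotaE.
Qed.

Lemma e_omegaD x y : e_omega n z (x + y) = e_omega n z x + e_omega n z y.
Proof.
rewrite !e_omegaE -mulrDr -big_split; congr (_ * _); apply: eq_bigr => g _ /=.
by rewrite rmorphD mulrDr.
Qed.

Lemma e_omegaM c x : (forall g, g c = c) -> e_omega n z (c * x) = c * e_omega n z x.
Proof.
move=> gc; rewrite !e_omegaE mulrCA; congr (_ * _); rewrite mulr_sumr.
by apply: eq_bigr => g _; rewrite rmorphM /= gc mulrCA.
Qed.

Lemma e_omegaZ c x : e_omega n z (iota c * x) = iota c * e_omega n z x.
Proof. by apply: e_omegaM => g; apply: gal_iota. Qed.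

Lemma e_omegaN x : e_omega n z (- x) = - e_omega n z x.
Proof. by rewrite -mulN1r e_omegaM ?mulN1r // => g; rewrite rmorphN rmorph1. Qed.

Lemma e_omega_sum (I : Type) (r : seq I) (P : pred I) (F : I -> K) :
  e_omega n z (\sum_(i <- r | P i) F i) = \sum_(i <- r | P i) e_omega n z (F i).
Proof.
elim/big_rec2: _ => [|i x y _ <-]; last exact: e_omegaD.
by rewrite -[0](mul0r 0) e_omegaM ?mul0r // => g; rewrite rmorph0.
Qed.

Lemma e_omega_gal h x : e_omega n z (h x) = h (e_omega n z x).
Proof.
rewrite !e_omegaE rmorphM fmorphV rmorph_nat rmorph_sum; congr (_ * _).
by apply: eq_bigr => g _; rewrite rmorphM /= gal_inv_iota gal_comm.
Qed.

Lemma e_omega_Delta d x : d \in Delta n z ->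
  e_omega n z (d x) = iota (teichmuller z d) * e_omega n z x.
Proof.
move=> dD; rewrite !e_omegaE mulrCA; congr (_ * _).
rewrite [in RHS](reindex_inj (mulgI d)) mulr_sumr; apply: eq_big => g /=.
  by rewrite Delta_mulr.
move=> _; rewrite teichmullerM rmorphM invfM gal_mul !mulrA mulfV ?mul1r //.
exact: teichmuller_neq0.
Qed.

(** On Delta the exponent satisfies t^p = t modulo p^(n+1), so w = w^(p^n) is congruent to t^(p^n),
    hence to t. *)
Lemma teichmuller_cong g t : g z = z ^+ t -> g \in Delta n z ->
  exists c : Zp, teichmuller z g = t%:R + p%:R ^+ n.+1 * c.
Proof.
move=> gt; rewrite DeltaP => /eqP g1.
have [w1 [b wb]] := teichmullerP gt; set w := teichmuller z g in w1 wb *.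
have [|c cE] := @prim_cong (t ^ p) t.
  by rewrite -(gal_expg _ gt) -[X in (g ^+ X)%g](prednK (prime_gt0 p_pr)) expgS g1 mulg1.
have tk k : exists d, (t%:R : Zp) ^+ (p ^ k) = t%:R + p%:R ^+ n.+1 * d.
  elim: k => [|k [d IH]]; first by exists 0; rewrite expn0 expr1 mulr0 addr0.
  have [d' d'E] := expr_congrM p (p%:R ^+ n.+1) (t%:R : Zp) d.
  rewrite expnSr exprM IH d'E -[t%:R ^+ p]natrX cE; exists (c + d'); ring.
have [|d] := @expr_congr _ _ p_pr 1 n w t%:R b isT; first by rewrite expr1 -wb addrC subrK.
have wk k : w ^+ (p ^ k) = w.
  elim: k => [|k IH]; first by rewrite expr1.
  by rewrite expnSr exprM IH (expr_pred _ (prime_gt0 p_pr)) w1 mul1r.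
rewrite wk => ->; have [e ->] := tk n; exists (e + d); rewrite add1n; ring.
Qed.

Lemma sigma_decomp m : coprime p m -> exists d t b : _,
  [/\ d \in Delta n z, d z = z ^+ t, b = 1 %[mod p],
      exists c : Zp, (t * b)%:R = m%:R + p%:R ^+ n.+1 * c & exists c : Zp, t%:R = m%:R + p%:R * c].
Proof.
(* t is the Teichmuller part of m: congruent to m modulo p, with t^(p-1) = 1 modulo p^(n+1). *)
move=> cm; have [t tE] : exists t, t = (m ^ (p ^ n))%N by eexists.
have ct : coprime p t by rewrite tE coprimeXr.
have p21 : (p.-2.+1 = p.-1)%N by rewrite prednK // -subn1 subn_gt0 prime_gt1.
have t1 : (t ^ p.-1 = 1 %[mod q])%N.
  have := @Euler_exp_totient m q; rewrite coprimeXr 1?coprime_sym // => /(_ isT).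
  by rewrite totient_pfactor //= mulnC expnM -tE.
have tm : (t = m %[mod p])%N.
  rewrite tE; elim: (n) => [|k IH]; first by rewrite expn0 expn1.
  by rewrite expnSr expnM fermat_little.
(* Since t^(p-1) = 1 modulo p^(n+1), t^(p-2) stands for the inverse of t and b for m / t. *)
exists (sigma z t), t, (m * t ^ (p.-2))%N; split.
- rewrite DeltaP; apply/eqP; apply: gal_ext.
  rewrite (gal_expg _ (sigmaE ct)) gal_id -[RHS]expr1.
  by apply/eqP; rewrite (eq_prim_root_expr z_prim) t1.
- exact: sigmaE.
- have qp : (p %| q)%N by rewrite expnS dvdn_mulr.
  rewrite -modnMml -tm modnMml -expnS; rewrite p21.
  by rewrite -(modn_dvdm _ qp) t1 modn_dvdm.
- have : ((t * (m * t ^ p.-2)) = m %[mod q])%N.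
    rewrite mulnCA -expnS; rewrite p21.
    by rewrite -modnMmr t1 modnMmr muln1.
  by move=> e; apply: residue_eqmod; rewrite !residue_nat.
- have [|c ->] := @residue_eqmod _ p_pr t%:R m%:R 1; last by exists c; rewrite expr1.
  by rewrite !residue_nat expn1.
Qed.

(** * The group Gamma_n and its generator gamma0 *)

Lemma Gamma_fix g : (g \in Gamma n z) = (g (zeta n z 0) == zeta n z 0).
Proof.
rewrite /Gamma gal_kHom ?subvf // /kHom ahomWin andTb.
apply/idP/eqP => [/FadjoinP[_ /fixedSpaceP]|gz] //.
by apply/FadjoinP; rewrite sub1v; split=> //; apply/fixedSpaceP.
Qed.

Lemma GammaP g b : g z = z ^+ b -> (g \in Gamma n z) = (b == 1 %[mod p])%N.
Proof.
move=> gb; rewrite Gamma_fix /zeta subn0 rmorphXn /= gb -exprM mulnC.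
rewrite (eq_prim_root_expr z_prim) -[X in _ == X %[mod _]]muln1 expnSr -!muln_modr.
by rewrite eqn_pmul2l // expn_gt0 prime_gt0.
Qed.

Lemma sigma_Gamma b : b = 1 %[mod p] -> sigma z b \in Gamma n z.
Proof.
move=> b1; rewrite (@GammaP _ b) ?b1 // sigmaE // prime_coprime //.
by rewrite /dvdn b1 modn_small ?prime_gt1.
Qed.

Local Notation gamma0 := (sigma z (1 + p)).

Lemma gamma0_coprime : coprime p (1 + p).
Proof. by rewrite /coprime gcdnDr gcdn1. Qed.

Lemma gamma0X k : (gamma0 ^+ k)%g z = z ^+ ((1 + p) ^ k).
Proof. exact/gal_expg/sigmaE/gamma0_coprime. Qed.

Lemma gamma0_Gamma : gamma0 \in Gamma n z.
Proof. by apply: sigma_Gamma; rewrite modnDr. Qed.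

Lemma expr1p k : exists c : Zp, (1 + p)%:R ^+ (p ^ k) = 1 + p%:R ^+ k.+1 * (1 + p%:R * c).
Proof.
elim: k => [|k [c IH]].
  by exists 0; rewrite expn0 !expr1 natrD mulr0 addr0 mulr1.
have [d] := expr1D_prime p_pr (1 + p%:R * c) p3 (ltn0Sn k).
rewrite expnSr exprM IH => ->; exists (c + p%:R ^+ k * d).
by rewrite [p%:R ^+ k.+1]exprS; ring.
Qed.

Lemma gamma0_generates b m : b = 1 %[mod p] -> exists k (d : Zp),
  (1 + p)%:R ^+ k = b%:R + p%:R ^+ m.+1 * d.
Proof.
move=> b1; have [e bE] : exists e : Zp, b%:R = 1 + p%:R * e.
  have [|e ->] := @residue_eqmod _ p_pr b%:R 1%:R 1; last by exists e; rewrite expr1.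
  by rewrite !residue_nat expn1.
elim: m => [|m [k [d IH]]].
  by exists 0%N, (- e); rewrite bE expr0 expr1; ring.
have [d0 [d1 dE]] := padic_approx d 1; have [c cE] := expr1p m.
(* (1 + p)^(p^m) is 1 + p^(m+1) modulo p^(m+2), so its power (p - 1) d0 adds - d0 p^(m+1) and
   cancels the error digit d0. *)
exists (k + p ^ m * (p.-1 * d0))%N.
rewrite exprD exprM IH cE.
have [h hE] := expr1D_linear (p%:R ^+ m.+1 * (1 + p%:R * c)) (p.-1 * d0).
pose h' := c * (p.-1 * d0)%:R + p%:R ^+ m * (1 + p%:R * c) ^+ 2 * h.
have h'E : (1 + p%:R ^+ m.+1 * (1 + p%:R * c)) ^+ (p.-1 * d0) =
   1 + p%:R ^+ m.+1 * (p.-1 * d0)%:R + p%:R ^+ m.+2 * h'.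
  by rewrite hE /h' !exprS; ring.
move: h' h'E => h' h'E.
have p1 : (p.-1)%:R = p%:R - 1 :> Zp by rewrite -subn1 natrB ?prime_gt0.
rewrite h'E natrM p1 dE expr1 bE.
exists (d0%:R + d1 + e * (p%:R - 1) * d0%:R +
  p%:R ^+ m * (d0%:R + p%:R * d1) * (p%:R - 1) * d0%:R +
  h' * (1 + p%:R * e + p%:R ^+ m.+1 * (d0%:R + p%:R * d1))).
by rewrite !exprS; ring.
Qed.

(** * The module generated by [gamma0 - 1 - p] *)

Section Span.
Context (y0 : K).
Local Notation S := (ZpGamma_span n z y0).

Lemma spanP x : S x <-> exists a : gal -> Zp, x = \sum_(g in Gamma n z) iota (a g) * g y0.
Proof.
split=> [[a _ <-]|[a ->]]; exists a => //; rewrite /gract; apply: eq_bigr => g _;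
  by rewrite iotaE.
Qed.

Lemma span_gal h : h \in Gamma n z -> S (h y0).
Proof.
move=> hG; apply/spanP; exists (fun g => (g == h)%:R).
rewrite (bigD1 h) //= eqxx rmorph1 mul1r big1 ?addr0 // => g /andP[_ /negPf ->].
by rewrite rmorph0 mul0r.
Qed.

Lemma spanD x y : S x -> S y -> S (x + y).
Proof.
move=> /spanP[a ->] /spanP[b ->]; apply/spanP; exists (fun g => a g + b g).
by rewrite -big_split; apply: eq_bigr => g _; rewrite rmorphD mulrDl.
Qed.

Lemma spanZ c x : S x -> S (iota c * x).
Proof.
move=> /spanP[a ->]; apply/spanP; exists (fun g => c * a g).
by rewrite mulr_sumr; apply: eq_bigr => g _; rewrite rmorphM mulrA.
Qed.

Lemma span0 : S 0.
Proof.
by apply/spanP; exists (fun=> 0); rewrite big1 // => g _; rewrite rmorph0 mul0r.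
Qed.

Lemma spanN x : S x -> S (- x).
Proof. by move=> /(spanZ (-1)); rewrite rmorphN rmorph1 mulN1r. Qed.

Lemma span_sum (I : Type) (r : seq I) (P : pred I) (F : I -> K) :
  (forall i, P i -> S (F i)) -> S (\sum_(i <- r | P i) F i).
Proof. by move=> FS; elim/big_ind: _ => //; [exact: span0 | exact: spanD]. Qed.

Lemma span_Gamma h x : h \in Gamma n z -> S x -> S (h x).
Proof.
move=> hG /spanP[a ->]; rewrite rmorph_sum; apply: span_sum => g gG.
rewrite rmorphM /= gal_iota -gal_mul; apply: spanZ; apply: span_gal.
exact: groupM.
Qed.

End Span.

Local Notation scT := (script_T n z).
Local Notation tau := (e_omega n z (script_T n z)).
Local Notation tm m := (Emap n iota z ((1 + 'X) ^+ m)).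
Local Notation S := (ZpGamma_span n z (gamma0_sub z tau)).

Lemma script_TE : scT = tm 1.
Proof.
rewrite Emap_X /script_T (reindex_inj rev_ord_inj); apply: eq_bigr => i _ /=.
by rewrite /zeta muln1 subSS subKn // -ltnS.
Qed.

Lemma sigma_Emap m : coprime p m -> sigma z m scT = tm m.
Proof.
move=> cm; rewrite script_TE !Emap_X rmorph_sum; apply: eq_bigr => j _.
by rewrite rmorphM fmorphV rmorphXn rmorph_nat rmorphXn /= sigmaE // muln1 -exprM mulnC.
Qed.

Lemma gal_subZ g x c y : g (x - iota c * y) = g x - iota c * g y.
Proof. by rewrite rmorphB rmorphM /= gal_iota. Qed.

Lemma span_gamma0 k : S ((gamma0 ^+ k)%g tau - (1 + p)%:R ^+ k * tau).
Proof.
elim: k => [|k IH]; first by rewrite expg0 gal_id expr0 mul1r subrr; apply: span0.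
rewrite expgSr gal_mul exprS.
have -> : gamma0 ((gamma0 ^+ k)%g tau) - (1 + p)%:R * (1 + p)%:R ^+ k * tau =
   gamma0 ((gamma0 ^+ k)%g tau - (1 + p)%:R ^+ k * tau) +
   iota ((1 + p)%:R ^+ k) * gamma0_sub z tau.
  have -> : (1 + p)%:R ^+ k = iota ((1 + p)%:R ^+ k) by rewrite rmorphXn rmorph_nat.
  by rewrite gal_subZ /gamma0_sub natrD; ring.
apply: spanD; first exact/span_Gamma/IH/gamma0_Gamma.
apply: spanZ; have := span_gal (gamma0_sub z tau) (group1 _).
by rewrite gal_id; apply.
Qed.

(** gamma0^(p^n) = 1 puts (1 - (1 + p)^(p^n)) tau in the span, and this coefficient is p^(n+1) times
    a unit. *)
Lemma span_pX : S (pK ^+ n.+1 * tau).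
Proof.
have [c cE] := expr1p n; have := span_gamma0 (p ^ n).
have -> : (gamma0 ^+ (p ^ n))%g = 1%g.
  apply: gal_ext; rewrite gamma0X gal_id -[RHS]expr1; apply: (@cong_prim _ _ (1 + p%:R * c)).
  by rewrite natrX cE.
rewrite gal_id -(rmorph_nat iota) -rmorphXn cE.
move=> /spanN/(spanZ (1 + p%:R * c)^-1).
move: (unit_1Dp c); set v := 1 + p%:R * c => uv.
have e : v^-1 * (1 + p%:R ^+ n.+1 * v - 1) = p%:R ^+ n.+1.
  by rewrite [1 + _]addrC addrK mulrCA mulVr // mulr1.
congr S; transitivity (iota (v^-1 * (1 + p%:R ^+ n.+1 * v - 1)) * tau).
  by rewrite rmorphM rmorphB rmorph1; ring.
by rewrite e rmorphXn rmorph_nat.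
Qed.

Lemma span_sigma b : b = 1 %[mod p] -> S (sigma z b tau - b%:R * tau).
Proof.
move=> b1; have [k [d kE]] := gamma0_generates n b1.
have -> : sigma z b = (gamma0 ^+ k)%g.
  apply: gal_ext; rewrite gamma0X sigmaE; last first.
    by rewrite prime_coprime // /dvdn b1 modn_small ?prime_gt1.
  by apply/esym; apply: (@cong_prim _ _ d); rewrite natrX kE.
have -> : (gamma0 ^+ k)%g tau - b%:R * tau =
   (gamma0 ^+ k)%g tau - (1 + p)%:R ^+ k * tau + iota d * (pK ^+ n.+1 * tau).
  have := congr1 iota kE; rewrite rmorphXn rmorphD rmorphM rmorphXn !rmorph_nat => ->.
  by ring.
by apply: spanD; [exact: span_gamma0 | apply/spanZ/span_pX].
Qed.

(** sigma_m splits into d in Delta and sigma_b in Gamma. Under e_omega, d becomes a scalar congruent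
    to t, sigma_b acts as b modulo the span, and t b = m modulo p^(n+1). *)
Lemma span_Emap_coprime m : coprime p m -> S (e_omega n z (tm m) - m%:R * tau).
Proof.
move=> cm; have [d [t [b [dD dt b1 [c cE] _]]]] := sigma_decomp cm.
have cb : coprime p b by rewrite prime_coprime // /dvdn b1 modn_small ?prime_gt1.
have mE : sigma z m = (sigma z b * d)%g.
  apply: gal_ext; rewrite gal_mul !sigmaE // rmorphXn /= dt -exprM.
  by apply/esym; apply: cong_prim cE.
have [c' c'E] := teichmuller_cong dt dD.
rewrite -(sigma_Emap cm) mE gal_mul e_omega_Delta // e_omega_gal c'E.
have -> : iota (t%:R + p%:R ^+ n.+1 * c') * sigma z b tau - m%:R * tau =
   iota (t%:R + p%:R ^+ n.+1 * c') * (sigma z b tau - b%:R * tau) +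
   iota (c' * b%:R + c) * (pK ^+ n.+1 * tau).
  have := congr1 iota cE; rewrite natrM rmorphD !rmorphM rmorphXn !rmorph_nat => e.
  move: (sigma z b tau) tau => s t0; rewrite !rmorphD !rmorphM !rmorphXn !rmorph_nat.
  by apply: (eq_sub (congr1 (fun v => v * t0) e)); ring.
by apply: spanD; apply: spanZ; [exact: span_sigma | exact: span_pX].
Qed.

Lemma e_omega_const c : (forall g, g c = c) -> e_omega n z c = 0.
Proof.
(* As p is odd, 2 is prime to p and not 1 modulo p, so its Teichmuller part gives an element of
   Delta with nontrivial omega-value. *)
move=> gc; have c2 : coprime p 2 by rewrite prime_coprime // gtnNdvd.
have [d [t [b [dD dt _ _ [w wE]]]]] := sigma_decomp c2.
have e := e_omega_Delta c dD; rewrite gc in e.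
have [_ [b' b'E]] := teichmullerP dt; set T := teichmuller z d in e b'E.
have T1 : T != 1.
  apply/eqP => T1; apply: (@padic_p_nunit p p_pr (- (w + b'))).
  apply: (eq_sub b'E); rewrite T1 wE; ring.
apply/eqP; have : (1 - iota T) * e_omega n z c == 0.
  by rewrite mulrBl mul1r subr_eq0 -e.
rewrite mulf_eq0 subr_eq0 -(rmorph1 iota) (inj_eq iota_inj) eq_sym (negPf T1).
by [].
Qed.

Lemma gal_pX g k : g (pK ^- k) = pK ^- k.
Proof. by rewrite fmorphV rmorphXn rmorph_nat. Qed.

(** Replacing m by m + k p^n multiplies z^m by the k-th power of a primitive p-th root of unity.
    Summed over k, the term j = 0 vanishes and each later term is counted p times. *)
Lemma Emap_distribution m :
  tm (p * m) = \sum_(k < p) tm (m + k * p ^ n) + pK ^- n.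
Proof.
rewrite (Emap_Xp iota_inj z_prim) Emap_X big_ord_recl /=.
rewrite expn0 mul1n expr0 invr1 mul1r addrAC subrr add0r; congr (_ + _).
have -> : \sum_(k < p) tm (m + k * p ^ n) =
    \sum_(k < p) \sum_(j < n.+1) pK ^- j * z ^+ (p ^ j * (m + k * p ^ n)).
  by apply: eq_bigr => k _; rewrite Emap_X.
rewrite exchange_big big_ord_recl /= [X in _ = X + _](_ : _ = 0) ?add0r; last first.
  have zp : (z ^+ (p ^ n)) ^+ p - 1 = 0.
    by rewrite -exprM -expnSr (prim_expr_order z_prim) subrr.
  move: zp; rewrite subrX1 => /eqP; rewrite mulf_eq0 subr_eq0.
  rewrite (negPf (zeta0_neq1 p_pr z_prim)) => /eqP s0.
  transitivity (z ^+ m * \sum_(i < p) (z ^+ (p ^ n)) ^+ i); last by rewrite s0 mulr0.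
  rewrite mulr_sumr; apply: eq_bigr => i _.
  by rewrite expn0 mul1n expr0 invr1 mul1r exprD mulnC exprM.
rewrite mulr_sumr; apply: eq_bigr => j _; rewrite /bump /= add1n.
have zk (k : 'I_p) : z ^+ (p ^ j.+1 * (m + k * p ^ n)) = z ^+ (p ^ j.+1 * m).
  rewrite mulnDr exprD; have -> : (p ^ j.+1 * (k * p ^ n) = q * (p ^ j * k))%N.
    by rewrite !expnS; ring.
  by rewrite [z ^+ (q * _)]exprM (prim_expr_order z_prim) expr1n mulr1.
by rewrite mulrCA mulr_natl -mulr_sumr (eq_bigr _ (fun k _ => zk k)) sumr_const card_ord.
Qed.

Lemma span_Emap_valuation v m : (v <= n)%N -> (p ^ v %| m)%N -> ~~ (p ^ v.+1 %| m)%N ->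
  S (e_omega n z (tm m) - m%:R * tau).
Proof.
elim: v m => [|v IH] m vn; first by rewrite expn1 -prime_coprime // => _ /span_Emap_coprime.
rewrite expnS => /dvdnP[l ml] nm; have [m' m'E] : exists m', m' = (l * p ^ v)%N by eexists.
have mE : m = (p * m')%N by rewrite ml m'E; ring.
have dm' k : (p ^ v %| m' + k * p ^ n)%N.
  by rewrite m'E dvdn_add ?dvdn_mull // dvdn_exp2l // ltnW.
have ndm' k : ~~ (p ^ v.+1 %| m' + k * p ^ n)%N.
  rewrite dvdn_addl; last by rewrite dvdn_mull // dvdn_exp2l.
  by move: nm; rewrite mE expnS dvdn_pmul2l // prime_gt0.
(* The shifts k p^n add up to p^n p (p - 1) / 2; as p is odd this is a multiple of p^(n+1), which
   [span_pX] absorbs. *)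
have [l' sumk] : exists l', (\sum_(k < p) k = p * l')%N.
  have /dvdnP[l' e] : (p %| 'C(p, 2))%N by rewrite prime_dvd_bin.
  by exists l'; rewrite mulnC -e -bin2_sum big_mkord.
rewrite mE Emap_distribution e_omegaD (e_omega_const (c := pK ^- n)) ?addr0; last first.
  by move=> g; apply: gal_pX.
rewrite [e_omega n z (\sum_(k < p) _)]e_omega_sum.
have -> : \sum_(k < p) e_omega n z (tm (m' + k * p ^ n)) - (p * m')%:R * tau =
   \sum_(k < p) (e_omega n z (tm (m' + k * p ^ n)) - (m' + k * p ^ n)%:R * tau) +
   iota l'%:R * (pK ^+ n.+1 * tau).
  rewrite sumrB -mulr_suml -natr_sum big_split /= sum_nat_const card_ord -big_distrl /= sumk.
  move: tau => t0; rewrite natrD !natrM natrX rmorph_nat exprS.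
  ring.
apply: spanD; last exact/spanZ/span_pX.
by apply: span_sum => k _; apply: IH (dm' k) (ndm' k); apply: ltnW.
Qed.

Lemma span_Emap_exp m : S (e_omega n z (tm m) - m%:R * tau).
Proof.
have [/dvdnP[l ->]|nqm] := boolP (q %| m)%N.
  rewrite [e_omega n z (tm _)]e_omega_const; last first.
    move=> g; rewrite Emap_X rmorph_sum; apply: eq_bigr => j _.
    rewrite rmorphM /= gal_pX mulnCA mulnA mulnC exprM (prim_expr_order z_prim) expr1n.
    by rewrite rmorph1.
  rewrite sub0r natrM natrX -mulrA -(rmorph_nat iota l).
  by apply: spanN; apply: spanZ; apply: span_pX.
have m0 : (0 < m)%N by case: m nqm => //; rewrite dvdn0.
apply: (@span_Emap_valuation (logn p m)).
- by rewrite -ltnS ltnNge; apply: contra nqm; rewrite -pfactor_dvdn.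
- exact: pfactor_dvdnn.
- by rewrite pfactor_dvdn // ltnn.
Qed.

(* By linearity from [span_Emap_exp], [e_omega (Emap f)] is [f`_1 * tau] modulo the
   span for every [f]. *)
Lemma span_Emap (f : {poly Zp}) : f`_1 = 0 -> S (e_omega n z (Emap n iota z f)).
Proof.
move=> f1; have [g gE] : exists g : {poly Zp}, g = f \Po ('X - 1) by eexists.
have fE : f = \sum_(i < size g) (g`_i)%:P * (1 + 'X) ^+ i.
  transitivity (g \Po (1 + 'X)).
    by rewrite gE -comp_polyA comp_polyB comp_polyX rmorph1 addrC addKr comp_polyXr.
  by rewrite comp_polyE; apply: eq_bigr => i _; rewrite mul_polyC.
have s0 : \sum_(i < size g) g`_i * i%:R = 0.
  have := congr1 (fun h : {poly Zp} => h`_1) fE; rewrite f1 coef_sum => e.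
  rewrite [RHS]e.
  by apply: eq_bigr => i _; rewrite coefCM coef1_1DX.
rewrite fE Emap_sum [e_omega n z (\sum_(i < size g) _)]e_omega_sum.
have -> : \sum_(i < size g) e_omega n z (Emap n iota z ((g`_i)%:P * (1 + 'X) ^+ i)) =
   \sum_(i < size g) iota g`_i * (e_omega n z (tm i) - i%:R * tau) +
   iota (\sum_(i < size g) g`_i * i%:R) * tau.
  rewrite rmorph_sum mulr_suml -big_split; apply: eq_bigr => i _ /=.
  by rewrite EmapZ e_omegaZ rmorphM rmorph_nat; ring.
rewrite s0 rmorph0 mul0r addr0; apply: span_sum => i _.
by apply: spanZ; apply: span_Emap_exp.
Qed.

Lemma e_omega_log_units :
  [set e_omega n z (log_p u) | u in principal_units z]%classic = S.
Proof.
apply/seteqP; split=> [_ [u /principal_unitsE uU <-]|x /spanP[a ->]].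
  have [y uy] := islog_exists p3 iota_inj z_prim K_dense uU.
  have [f [c [f1 yE]]] := log_is_Emap p3 iota_inj z_prim K_dense uU uy.
  rewrite (log_pE uU uy) yE e_omegaD [X in _ + X]e_omega_const ?addr0; last first.
    by move=> g; rewrite rmorphM /= gal_iota gal_pX.
  exact: span_Emap.
pose b g : nat := sval (gal_z g).
have bE g : g z = z ^+ b g by rewrite /b; case: gal_z.
have cb g : coprime p (b g) := gal_z_coprime (bE g).
have gE g : g = sigma z (b g) by apply: gal_ext; rewrite sigmaE.
(* Multiplying both exponents of the polynomial for the generator by [b g] applies g to its image,
   and the linear terms still cancel. *)
pose h : {poly Zp} := \sum_(g in Gamma n z)
  (a g)%:P * ((1 + 'X) ^+ (b g * (1 + p)) - (1 + p)%:R%:P * (1 + 'X) ^+ b g).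
have h1 : h`_1 = 0.
  rewrite coef_sum big1 // => g _; rewrite coefCM coefB coefCM !coef1_1DX natrM.
  by rewrite mulrC [(b g)%:R * _]mulrC subrr mul0r.
have hx : e_omega n z (Emap n iota z h) =
    \sum_(g in Gamma n z) iota (a g) * g (gamma0_sub z tau).
  rewrite /h -big_filter Emap_sum big_filter e_omega_sum; apply: eq_bigr => g _.
  rewrite EmapZ e_omegaZ EmapB EmapZ e_omegaD e_omegaN e_omegaZ.
  have -> : e_omega n z (tm (b g)) = g tau.
    by rewrite -(sigma_Emap (cb g)) -gE e_omega_gal.
  have -> : e_omega n z (tm (b g * (1 + p))) = g (gamma0 tau).
    rewrite -sigma_Emap; last by rewrite coprimeMr cb gamma0_coprime.
    have -> : sigma z (b g * (1 + p)) = (gamma0 * g)%g.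
      apply: gal_ext; rewrite gal_mul !sigmaE ?coprimeMr ?cb ?gamma0_coprime //.
      by rewrite rmorphXn /= bE -exprM.
    by rewrite gal_mul !e_omega_gal.
  congr (_ * _); rewrite /gamma0_sub; move: tau => t0.
  rewrite 2!rmorphB rmorphM /= gal_nat rmorph_nat natrD; ring.
(* Only the multiple of 'X^2 is realised by a unit; the constant coefficient contributes a
   Galois-invariant term, killed by e_omega. *)
have [s hE] : exists s, h = (h`_0)%:P + 'X^2 * s.
  have [s1 e1] := poly_div_X h; have [s2 e2] := poly_div_X s1.
  exists s2; rewrite {1}e1 {1}e2; have -> : s1`_0 = 0.
    by move: h1; rewrite e1 coefD coefC coefXM /= add0r.
  by rewrite polyC0 add0r mulrA -expr2.
have [u uU us] := Emap_log p3 iota_inj z_prim K_dense s.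
exists u; first exact/principal_unitsE.
rewrite (log_pE uU us) -hx hE EmapD e_omegaD [X in _ = X + _]e_omega_const ?add0r //.
move=> g; rewrite -[(h`_0)%:P]mulr1 EmapZ rmorphM /= gal_iota; congr (_ * _).
by rewrite rmorph_sum; apply: eq_bigr => j _; rewrite rmorphM /= gal_pX peval1 rmorph1.
Qed.

(** * The operator [l_n] *)

(** (1 + p)^k - 1 has valuation exactly 1 + v(k) for k > 0; a larger one would force a unit of Z_p
    to vanish. *)
Lemma order_1p k j (c : Zp) : (1 + p)%:R ^+ k = 1 + p%:R ^+ j.+1 * c -> (p ^ j %| k)%N.
Proof.
have [->|k0] := posnP k; first by rewrite dvdn0.
have [m pm kE] := pfactor_coprime p_pr k0; set v := logn p k in kE.
rewrite [in X in X -> _]kE mulnC exprM; have [d ->] := expr1p v.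
have [y ->] := expr1D_linear (p%:R ^+ v.+1 * (1 + p%:R * d)) m.
move=> e; rewrite kE dvdn_mull // dvdn_exp2l // leqNgt; apply/negP => vj.
have [l lE] : exists l, j.+1 = (v.+1 + l.+1)%N by exists (j - v.+1)%N; lia.
have um := @padic_unitP p p_pr m (m%:R * d + p%:R ^+ v * (1 + p%:R * d) ^+ 2 * y - p%:R ^+ l * c).
move: um; rewrite -prime_coprime // => /(_ pm); suff -> : m%:R + p%:R *
   (m%:R * d + p%:R ^+ v * (1 + p%:R * d) ^+ 2 * y - p%:R ^+ l * c) = 0 by rewrite unitr0.
apply: (mulfI (padic_pX_neq0 p_pr v.+1)); rewrite mulr0; apply: (eq_sub e).
by rewrite lE exprD !exprS; ring.
Qed.

Lemma zetaE i : zeta n z i = z ^+ (p ^ (n - i)). Proof. by []. Qed.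

Lemma gamma0_fix i k : (i <= n)%N ->
  ((gamma0 ^+ k)%g (zeta n z i) == zeta n z i) = (p ^ i %| k)%N.
Proof.
move=> ni; rewrite zetaE rmorphXn /= gamma0X -exprM (eq_prim_root_expr z_prim).
have qE : q = (p ^ (n - i) * p ^ i.+1)%N by rewrite -expnD addnS subnK.
rewrite qE mulnC -[X in _ == X %[mod _]]muln1 -!muln_modr eqn_pmul2l ?expn_gt0 ?prime_gt0 //.
apply/eqP/idP => [e|/dvdnP[l ->]].
  have [|c cE] := @residue_eqmod p p_pr ((1 + p) ^ k)%:R 1%:R i.+1.
    by rewrite !residue_nat.
  by apply: (@order_1p k i c); rewrite -natrX.
have [c cE] := expr1p i.
have [d dE] := @expr_congrM Zp l (p%:R ^+ i.+1) 1 (1 + p%:R * c).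
apply: (@padic_nat_cong p p_pr _ _ _ d); rewrite natrX mulnC exprM cE dE.
by rewrite expr1n.
Qed.

Lemma Gamma_gamma0 g : g \in Gamma n z -> exists k, g = (gamma0 ^+ k)%g.
Proof.
have [b gb] := gal_z g; rewrite (GammaP gb) => /eqP b1.
have [k [d kE]] := gamma0_generates n b1; exists k.
by apply: gal_ext; rewrite gamma0X gb; apply/esym; apply: (@cong_prim _ _ d); rewrite natrX kE.
Qed.

Lemma gamma0_order k l : (gamma0 ^+ k = gamma0 ^+ l)%g -> k = l %[mod p ^ n].
Proof.
wlog lk : k l / (l <= k)%N.
  move=> H; case: (leqP l k) => [/H //|/ltnW/H {}H /esym/H /esym]; exact.
move=> e; apply/eqP; rewrite eqn_mod_dvd //; rewrite -gamma0_fix //.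
have -> : (gamma0 ^+ (k - l) = 1)%g.
  by apply: (mulIg (gamma0 ^+ l)%g); rewrite mul1g -expgD subnK.
by rewrite gal_id.
Qed.

(** The Galois group of K over Q_p(zeta_{p^(i+1)}). *)
Definition Gamma_ i : {set gal} := [set g in Gamma n z | g (zeta n z i) == zeta n z i].

Lemma card_Gamma_ i : (i <= n)%N -> #|Gamma_ i| = (p ^ (n - i))%N.
Proof.
move=> ni; have o0 : #[gamma0]%g = (p ^ n)%N.
  apply/eqP; rewrite eqn_dvd order_dvdn -gamma0_fix // expg_order gal_id eqxx andbT.
  apply/eqP/gal_ext; rewrite gal_id; have zn : zeta n z n = z by rewrite zetaE subnn expr1.
  by have := gamma0_fix (p ^ n) (leqnn n); rewrite zn dvdnn => /eqP.
have -> : Gamma_ i = <[gamma0 ^+ (p ^ i)]>%g.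
  apply/setP => g; rewrite inE; apply/andP/cycleP => [[/Gamma_gamma0[k ->]]|[k ->]].
    by rewrite gamma0_fix // => /dvdnP[l ->]; exists l; rewrite -expgM mulnC.
  by rewrite -expgM gamma0_fix // dvdn_mulr // groupX // gamma0_Gamma.
by rewrite -orderE orderXdiv o0 ?dvdn_exp2l // expnB // prime_gt0.
Qed.

Lemma sum_Gamma_ i k : (i <= n)%N -> (k <= n)%N ->
  \sum_(g in Gamma_ i) g (zeta n z k) = if (k <= i)%N then pK ^+ (n - i) * zeta n z k else 0.
Proof.
move=> ni nk; have zX j l : (j + l <= n)%N -> zeta n z (j + l) ^+ (p ^ l) = zeta n z j.
  by move=> jl; rewrite !zetaE -exprM -expnD; congr (z ^+ (p ^ _)); lia.
case: leqP => [ki|ik].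
  rewrite -natrX -(card_Gamma_ ni) mulr_natl -sumr_const; apply: eq_bigr => g.
  rewrite inE => /andP[_ /eqP gi].
  by rewrite -(zX k (i - k)%N) ?subnKC // rmorphXn /= gi.
have k0 : (0 < k)%N by apply: leq_ltn_trans ik.
(* h fixes zeta_i, as i < k, and multiplies zeta_k by [zeta n z 0]. Reindexing by h shows that the
   sum equals itself times a p-th root of unity other than 1. *)
pose h := sigma z (1 + p ^ k); have ch : coprime p (1 + p ^ k).
  by rewrite prime_coprime // dvdn_addl ?dvdn_exp // gtnNdvd ?prime_gt1.
have hz j : (j <= n)%N -> h (zeta n z j) = zeta n z j * zeta n z j ^+ (p ^ k).
  by move=> jn; rewrite zetaE rmorphXn /= sigmaE // -!exprM -exprD mulnDl mul1n mulnC.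
have z1 j : (j < k)%N -> (j <= n)%N -> zeta n z j ^+ (p ^ k) = 1.
  move=> jk jn; rewrite zetaE -exprM -expnD; have -> : (n - j + k = n.+1 + (k - j.+1))%N by lia.
  by rewrite expnD exprM (prim_expr_order z_prim) expr1n.
have hi j : (j < k)%N -> (j <= n)%N -> h (zeta n z j) = zeta n z j.
  by move=> jk jn; rewrite hz // z1 // mulr1.
have hG g : (h * g \in Gamma_ i)%g = (g \in Gamma_ i).
  by rewrite !inE !Gamma_fix !gal_mul !hi.
set s := (X in X = 0); apply/eqP.
have e : s = s * zeta n z 0.
  rewrite {1}/s (reindex_inj (mulgI h)) mulr_suml; apply: eq_big => g; first exact: hG.
  rewrite hG inE Gamma_fix => /andP[/eqP g0 _].
  by rewrite gal_mul hz // rmorphM /= (zX 0%N k) // g0.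
have : s * (1 - zeta n z 0) == 0 by rewrite mulrBr mulr1 -e subrr.
rewrite mulf_eq0 subr_eq0 eq_sym => /orP[//|].
by rewrite zetaE subn0 eq_sym (negPf (zeta0_neq1 p_pr z_prim)).
Qed.

Lemma zeta_prim j : (j <= n)%N -> (p ^ j.+1).-primitive_root (zeta n z j).
Proof.
move=> jn; have := exp_prim_root z_prim (p ^ (n - j)); rewrite -zetaE.
have qE : q = (p ^ (n - j) * p ^ j.+1)%N by rewrite -expnD addnS subnK.
by rewrite {1}(_ : gcdn _ q = p ^ (n - j))%N ?[in (q %/ _)%N]qE ?mulKn ?expn_gt0 ?prime_gt0 //
  qE gcdnMr.
Qed.

Lemma Gamma_charX chi k : Gamma_char n z chi -> chi (gamma0 ^+ k)%g = chi gamma0 ^+ k.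
Proof.
move=> [chi1 chiM _]; elim: k => [|k IH]; first by rewrite expg0 chi1.
by rewrite expgSr chiM ?groupX ?gamma0_Gamma // IH exprSr.
Qed.

Lemma sigma_Gamma_ j a : (j <= n)%N -> a = 1 %[mod p ^ j.+1] -> sigma z a \in Gamma_ j.
Proof.
move=> jn a1; have ap : a = 1 %[mod p].
  have pp : (p %| p ^ j.+1)%N by rewrite dvdn_exp.
  by rewrite -(modn_dvdm a pp) a1 modn_dvdm.
have ca : coprime p a by rewrite prime_coprime // /dvdn ap modn_small ?prime_gt1.
rewrite inE sigma_Gamma //= zetaE rmorphXn /= sigmaE // -exprM mulnC exprM -zetaE.
by rewrite -[X in _ == X]expr1 (eq_prim_root_expr (zeta_prim jn)) a1.
Qed.

Lemma Gamma__exp j g : (j <= n)%N -> g \in Gamma_ j ->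
  exists2 a, a = 1 %[mod p ^ j.+1] & g = sigma z a.
Proof.
move=> jn; rewrite inE => /andP[_]; have [a ga] := gal_z g.
rewrite zetaE rmorphXn /= ga -exprM mulnC exprM -zetaE.
rewrite -[X in _ == X]expr1 (eq_prim_root_expr (zeta_prim jn)) => /eqP a1.
by exists a => //; apply: gal_ext; rewrite sigmaE // (gal_z_coprime ga).
Qed.

(** With i = j + 1, the congruences modulo p^(j+2) and p^(j+1) cut out [Gamma_ j.+1] and
    [Gamma_ j]. *)
Lemma conductorE j chi : (j < n)%N -> conductor z j.+1 chi <->
  {in Gamma_ j.+1, forall g, chi g = 1} /\ exists2 g, g \in Gamma_ j & chi g != 1.
Proof.
move=> jn; split=> [[triv [a a1 ac]]|[triv [g gG gc]]]; split.
- by move=> g /(Gamma__exp jn)[b b1 ->]; apply: triv.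
- by exists (sigma z a) => //; apply: sigma_Gamma_ => //; apply: ltnW.
- by move=> a a1; apply: triv; apply: sigma_Gamma_.
- by have [a a1 ga] := Gamma__exp (ltnW jn) gG; exists a => //; rewrite -ga.
Qed.

(* The characters of conductor [p^(j+2)] are [gamma0 |-> w^k] with [w] of order
   [p^(j+1)] and [k] prime to [p]. *)
Lemma e_coefS j g : (j < n)%N -> g \in Gamma n z ->
  e_coef n z j.+1 g = pK ^- n * ((if g \in Gamma_ j.+1 then (p ^ j.+1)%:R else 0) -
                                 (if g \in Gamma_ j then (p ^ j)%:R else 0)).
Proof.
move=> jn; have wp := zeta_prim (ltnW jn); set w := zeta n z j in wp.
(* A discrete logarithm to base gamma0, well defined modulo p^n; this is harmless because the order
   p^(j+1) of w divides p^n. *)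
have /choice[l lP] h : exists k, h \in Gamma n z -> h = (gamma0 ^+ k)%g.
  have [/Gamma_gamma0[k hk]|nh] := boolP (h \in Gamma n z); first by exists k.
  by exists 0%N.
have wX k a b : a = b %[mod p ^ n] -> w ^+ (k * a) = w ^+ (k * b).
  move=> ab; apply/eqP; rewrite (eq_prim_root_expr wp) -modnMmr.
  have d : (p ^ j.+1 %| p ^ n)%N by rewrite dvdn_exp2l.
  by rewrite -(modn_dvdm a d) ab modn_dvdm // modnMmr.
have lX k : l (gamma0 ^+ k)%g = k %[mod p ^ n].
  by apply: gamma0_order; rewrite -lP // groupX // gamma0_Gamma.
have lM a b : a \in Gamma n z -> b \in Gamma n z -> l (a * b)%g = l a + l b %[mod p ^ n].
  by move=> aG bG; rewrite {1}(lP a aG) {1}(lP b bG) -expgD lX.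
have lG i a : (i <= n)%N -> a \in Gamma n z -> (a \in Gamma_ i) = (p ^ i %| l a)%N.
  by move=> ni aG; rewrite inE aG /= {1}(lP a aG) gamma0_fix.
pose chi k : {ffun gal -> K} := [ffun h => if h \in Gamma n z then w ^+ (k * l h) else 0].
have chiE k h : h \in Gamma n z -> chi k h = w ^+ (k * l h) by rewrite ffunE => ->.
have chi_char k : Gamma_char n z (chi k).
  split.
  - rewrite chiE // -(expr0 w) -(muln0 k); apply: wX.
    by rewrite -(expg0 gamma0) lX.
  - move=> a b aG bG; rewrite !chiE ?groupM // -exprD -mulnDr; apply: wX.
    exact: lM.
  - by move=> a /negPf aG; rewrite ffunE aG.
have chi_g k : chi k gamma0 = w ^+ k.
  by rewrite chiE ?gamma0_Gamma // -[X in _ = w ^+ X]muln1; apply: wX;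
    rewrite -[gamma0]expg1 lX.
have g0X i : (gamma0 ^+ (p ^ i))%g \in Gamma n z by rewrite groupX // gamma0_Gamma.
have g0i i : (i <= n)%N -> (gamma0 ^+ (p ^ i))%g \in Gamma_ i.
  by move=> ni; rewrite inE g0X gamma0_fix //= dvdnn.
(* An explicit duplicate-free list of the characters of this conductor, which turns the sum over a
   classical set into a sum over exponents. *)
pose r := [seq chi k | k <- index_iota 0 (p ^ j.+1) & ~~ (p %| k)%N].
have r_uniq : uniq r.
  rewrite map_inj_in_uniq ?filter_uniq ?iota_uniq // => k k'.
  rewrite !mem_filter !mem_index_iota /= => /andP[_ kj] /andP[_ k'j].
  move=> /(congr1 (fun c : {ffun gal -> K} => c gamma0)); rewrite !chi_g => /eqP.
  by rewrite (eq_prim_root_expr wp) !modn_small // => /eqP.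
have pj k : (p ^ j.+1 %| k * p ^ j)%N = (p %| k)%N.
  by rewrite expnS dvdn_pmul2r // expn_gt0 prime_gt0.
have rE : [set chi | Gamma_char n z chi /\ conductor z j.+1 chi]%classic = [set` r]%classic.
  apply/seteqP; split=> c /=.
    move=> [cc /(conductorE _ jn)[triv [h hG ch]]].
    have x1 : c gamma0 ^+ (p ^ j.+1) = 1 by rewrite -Gamma_charX // triv ?g0i.
    have [k ck] := prim_rootP wp x1; apply/mapP; exists (val k).
      rewrite mem_filter mem_index_iota leq0n ltn_ord !andbT; apply/negP => pk.
      move/eqP: ch; apply; have hG' : h \in Gamma n z by move: hG; rewrite inE => /andP[].
      move: hG; rewrite lG ?(ltnW jn) // => /dvdnP[e le]; rewrite (lP h hG') Gamma_charX // ck.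
      by apply/eqP; rewrite -exprM -(prim_order_dvd wp) le mulnCA dvdn_mull // pj.
    apply/ffunP => h'; rewrite ffunE; case: ifP => hG'; last first.
      by have [_ _ ->] := cc; rewrite ?hG'.
    by rewrite {1}(lP h' hG') Gamma_charX // ck -exprM.
  move=> /mapP[k]; rewrite mem_filter => /andP[pk _] ->; split=> //.
  apply/(conductorE _ jn); split.
    move=> h hG; have hG' : h \in Gamma n z by move: hG; rewrite inE => /andP[].
    rewrite chiE //; move: hG; rewrite lG // => ld; apply/eqP.
    by rewrite -(prim_order_dvd wp) dvdn_mull.
  exists (gamma0 ^+ (p ^ j))%g; first by rewrite g0i // ltnW.
  by rewrite Gamma_charX // chi_g -exprM -(prim_order_dvd wp) pj.
move=> gG; rewrite /e_coef /= rE -fsbig_seq // big_map big_filter.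
rewrite -mulr_sumr; congr (_ * _).
have xj : ((w ^+ l g)^-1) ^+ (p ^ j.+1) = 1.
  by rewrite exprVn exprAC (prim_expr_order wp) expr1n invr1.
rewrite (lG j.+1 g jn gG) (lG j g (ltnW jn) gG).
rewrite (big_mkord (fun k => ~~ (p %| k)%N) (fun k => (chi k g)^-1)).
transitivity (\sum_(k < p ^ j.+1 | ~~ (p %| k)%N) ((w ^+ l g)^-1) ^+ k).
  apply: eq_bigr => k _; rewrite chiE //.
  by rewrite exprVn mulnC; congr (_^-1); apply: exprM.
rewrite (sum_root_of_unity_coprime p_pr) // exprVn !invr_eq1.
have -> : (w ^+ l g) ^+ p = w ^+ (l g * p) by apply/esym/exprM.
rewrite -!(prim_order_dvd wp).
by have -> : (p ^ j.+1 %| l g * p)%N = (p ^ j %| l g)%N by rewrite expnSr dvdn_pmul2r ?prime_gt0.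
Qed.

Lemma Gamma_0 : Gamma_ 0 = Gamma n z.
Proof. by apply/setP => g; rewrite inE Gamma_fix andbb. Qed.

Lemma gal_e_coef h i g : (i <= n)%N -> g \in Gamma n z -> h (e_coef n z i g) = e_coef n z i g.
Proof.
move=> ni gG; have natif (b : bool) m : h (if b then m%:R else 0) = if b then m%:R else 0.
  by case: b; [apply: gal_nat | rewrite rmorph0].
case: i ni => [|i] ni; first exact: gal_pX.
by rewrite e_coefS // rmorphM rmorphB /= gal_pX !natif.
Qed.

(** For i >= 1, [e_coefS] exhibits e_i as the difference of the normalised traces to levels i and i
    - 1. Both fix zeta_k for k < i, both kill it for k > i, and only the first fixes it for k =
    i. *)
Lemma sum_e_coef i k : (i <= n)%N -> (k <= n)%N ->
  \sum_(g in Gamma n z) e_coef n z i g * g (zeta n z k) = if k == i then zeta n z k else 0.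
Proof.
move=> ni nk.
have sumS j : \sum_(g in Gamma n z) (if g \in Gamma_ j then (p ^ j)%:R else 0) * g (zeta n z k) =
    (p ^ j)%:R * \sum_(g in Gamma_ j) g (zeta n z k).
  rewrite mulr_sumr big_mkcond [RHS]big_mkcond; apply: eq_bigr => g _ /=.
  rewrite !inE; case: (g \in Gamma n z) => //=.
  by case: ifP => _; rewrite ?mul0r.
have pp j x : (j <= n)%N -> pK ^- n * ((p ^ j)%:R * (pK ^+ (n - j) * x)) = x.
  by move=> nj; rewrite natrX [pK ^+ j * _]mulrA -exprD subnKC // mulKf ?(pKX_neq0 iota_inj).
case: i ni => [|i] ni.
  rewrite -mulr_sumr -Gamma_0 sum_Gamma_ // leqn0; case: eqP => _; last by rewrite mulr0.
  by have := pp 0%N (zeta n z k) isT; rewrite mul1r.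
under eq_bigr => g gG do rewrite e_coefS // -mulrA mulrBl.
rewrite -mulr_sumr sumrB !sumS !sum_Gamma_ ?(ltnW ni) //.
case: (ltngtP k i.+1) => [|ik|->].
- by rewrite ltnS => ki; rewrite ki mulrBr !pp ?subrr ?(ltnW ni).
- by rewrite leqNgt (ltnW ik) /= !mulr0 subrr mulr0.
- by rewrite ltnn mulr0 subr0; apply: pp.
Qed.

Local Notation ln_coef := (fun g => \sum_(i < n.+1) pK ^+ (n - i) * e_coef n z i g).

Lemma gal_ln_coef h g : g \in Gamma n z -> h (ln_coef g) = ln_coef g.
Proof.
move=> gG; rewrite rmorph_sum; apply: eq_bigr => i _.
by rewrite rmorphM rmorphXn rmorph_nat /= gal_e_coef // -ltnS.
Qed.

Lemma l_nE x : l_n n z x = \sum_(g in Gamma n z) ln_coef g * g x.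
Proof. by []. Qed.

Lemma l_nD x y : l_n n z (x + y) = l_n n z x + l_n n z y.
Proof. by rewrite !l_nE -big_split; apply: eq_bigr => g _; rewrite rmorphD mulrDr. Qed.

Lemma l_nM c x : (forall g, g c = c) -> l_n n z (c * x) = c * l_n n z x.
Proof.
move=> gc; rewrite !l_nE mulr_sumr; apply: eq_bigr => g _.
by rewrite rmorphM /= gc mulrCA.
Qed.

Lemma l_nZ c x : l_n n z (iota c * x) = iota c * l_n n z x.
Proof. by apply: l_nM => g; apply: gal_iota. Qed.

Lemma l_n_sum (I : Type) (r : seq I) (P : pred I) (F : I -> K) :
  l_n n z (\sum_(i <- r | P i) F i) = \sum_(i <- r | P i) l_n n z (F i).
Proof.
elim/big_rec2: _ => [|i x y _ <-]; last exact: l_nD.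
by rewrite -[0](mul0r 0) l_nM ?mul0r // => g; rewrite rmorph0.
Qed.

Lemma l_n_gal h x : l_n n z (h x) = h (l_n n z x).
Proof.
rewrite !l_nE rmorph_sum; apply: eq_bigr => g gG.
by rewrite rmorphM /= gal_ln_coef // gal_comm.
Qed.

Lemma l_n_e_omega x : e_omega n z (l_n n z x) = l_n n z (e_omega n z x).
Proof.
rewrite !l_nE e_omega_sum; apply: eq_bigr => g gG.
by rewrite e_omegaM ?e_omega_gal // => h; apply: gal_ln_coef.
Qed.

Lemma l_n_script_T : l_n n z scT = T_n n z.
Proof.
rewrite l_n_sum; apply: eq_bigr => k _; have nk : (k <= n)%N by rewrite -ltnS.
rewrite l_nM => [|g]; last exact: gal_pX.
have -> : l_n n z (zeta n z k) = \sum_(i < n.+1) pK ^+ (n - i) *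
    \sum_(g in Gamma n z) e_coef n z i g * g (zeta n z k).
  rewrite l_nE (eq_bigr _ (fun g _ => mulr_suml _ _ _ _)) exchange_big.
  by apply: eq_bigr => i _; rewrite mulr_sumr; apply: eq_bigr => g _; rewrite mulrA.
rewrite (bigD1 k) //= [X in _ + X]big1 ?addr0 => [|i ik]; last first.
  have ni : (i <= n)%N by rewrite -ltnS.
  by rewrite sum_e_coef // eq_sym val_eqE (negPf ik) mulr0.
by rewrite sum_e_coef // eqxx mulKf ?(pKX_neq0 iota_inj).
Qed.

Lemma l_n_gamma0_sub x : l_n n z (gamma0_sub z x) = gamma0_sub z (l_n n z x).
Proof.
rewrite /gamma0_sub; have l_nN y : l_n n z (- y) = - l_n n z y.
  by rewrite -mulN1r l_nM ?mulN1r // => g; rewrite rmorphN rmorph1.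
by rewrite !l_nD !l_nN l_n_gal l_nM // => g; apply: gal_nat.
Qed.

Lemma e_omega_L_units :
  [set e_omega n z (L_n n z u) | u in principal_units z]%classic =
  ZpGamma_span n z (gamma0_sub z (e_omega n z (T_n n z))).
Proof.
have yE : gamma0_sub z (e_omega n z (T_n n z)) = l_n n z (gamma0_sub z tau).
  by rewrite l_n_gamma0_sub -l_n_script_T l_n_e_omega.
have sumE (a : gal -> Zp) : l_n n z (\sum_(g in Gamma n z) iota (a g) * g (gamma0_sub z tau)) =
    \sum_(g in Gamma n z) iota (a g) * g (gamma0_sub z (e_omega n z (T_n n z))).
  by rewrite l_n_sum; apply: eq_bigr => g _; rewrite l_nZ l_n_gal yE.
apply/seteqP; split=> [_ [u uU <-]|x /spanP[a ->]].
  have : S (e_omega n z (log_p u)) by rewrite -e_omega_log_units; exists u.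
  move=> /spanP[a aE]; apply/spanP; exists a.
  by rewrite /L_n l_n_e_omega aE sumE.
have : S (\sum_(g in Gamma n z) iota (a g) * g (gamma0_sub z tau)).
  by apply/spanP; exists a.
rewrite -e_omega_log_units => -[u uU e]; exists u => //.
by rewrite /L_n l_n_e_omega e sumE.
Qed.

End Cyclotomic.

Local Open Scope classical_set_scope.

Theorem theorem1p19 (p : nat) (p_pr : prime p) (p_ge5 : (5 <= p)%N) (n : nat)
    (K : splittingFieldType (padic p_pr)) (z : K)
    (z_prim : (p ^ n.+1).-primitive_root z)
    (K_gen : <<1; z>>%VS = fullv) :
  [set e_omega n z (log_p u) | u in principal_units z] =
    ZpGamma_span n z (gamma0_sub z (e_omega n z (script_T n z)))
  /\
  [set e_omega n z (L_n n z u) | u in principal_units z] =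
    ZpGamma_span n z (gamma0_sub z (e_omega n z (T_n n z))).
Proof.
have p3 : (2 < p)%N by apply: leq_trans p_ge5.
split.
- exact: (e_omega_log_units p3 z_prim K_gen (iota := padic_embedding K)).
- exact: (e_omega_L_units p3 z_prim K_gen (iota := padic_embedding K)).
Qed.
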